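(* Let $R$ be a Noetherian ring of positive characteristic $p$. Then the following are equivalent: (1) $R$ is a regular ring. (2) $(I^{[q]}:J^{[q]})=(I:J)^{[q]}$ for all ideals $I$ and $J$ of $R$ and for all $q=p^e$, $e\geq 0$. (3) $(\mathfrak{a}^{[q]}:x^q)=(\mathfrak{a}:x)^{[q]}$ for all ideals $\mathfrak{a}$ of $R$ which are primary to some maximal ideal of $R$, all elements $x\in R$, and all $q=p^e$, $e\geq 0$.
   Context: Rings are commutative with identity; $R$ having positive characteristic $p$ means $p$ is a prime number and $p=0$ in $R$. A Noetherian ring is regular if its localization at every prime ideal is a regular local ring. For an ideal $I$ of $R$ and $q=p^e$, the Frobenius power $I^{[q]}$ is the ideal generated by all $a^q$ with $a\in I$. For ideals $I,J$ the colon ideal is $(I:J)=\{r\in R: rJ\subseteq I\}$, and for $x\in R$, $(I:x)=\{r\in R: rx\in I\}$. *)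

(* Defs.v *)
From HB Require Import structures.
From mathcomp Require Import all_boot all_order all_algebra.
From mathcomp Require Import boolp classical_sets.
From mathcomp Require Import ring.

Set Implicit Arguments.
Unset Strict Implicit.
Unset Printing Implicit Defensive.

Import GRing.Theory.
Local Open Scope classical_set_scope.
Local Open Scope quotient_scope.
Local Open Scope ring_scope.

(* Rings are [comPzRingType]s, so the zero ring is allowed. *)

Section Ideals.
Variable R : comPzRingType.
Implicit Types (I J P Q M : set R) (S : set R).

Definition is_ideal I : Prop :=
  [/\ I 0, forall a b, I a -> I b -> I (a + b) & forall r a, I a -> I (r * a)].

Definition ideal_gen S : set R := smallest is_ideal S.

Definition finitely_generated I : Prop :=
  exists s : seq R, I = ideal_gen [set` s].

Definition noetherian : Prop := forall I, is_ideal I -> finitely_generated I.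

Definition is_prime_ideal P : Prop :=
  [/\ is_ideal P, ~ P 1 & forall a b, P (a * b) -> P a \/ P b].

Definition is_maximal_ideal M : Prop :=
  [/\ is_ideal M, ~ M 1
    & forall I, is_ideal I -> M `<=` I -> I = M \/ I = setT].

Definition radical I : set R := [set a | exists n : nat, I (a ^+ n)].

Definition is_primary_ideal Q : Prop :=
  [/\ is_ideal Q, ~ Q 1 & forall a b, Q (a * b) -> Q a \/ radical Q b].

Definition is_primary_to Q P : Prop := is_primary_ideal Q /\ radical Q = P.

Definition frobenius_power I (q : nat) : set R :=
  ideal_gen [set a ^+ q | a in I].

Definition colon I J : set R := [set r | forall y, J y -> I (r * y)].

Definition colon_elt I (x : R) : set R := [set r | I (r * x)].

Definition prime_chain (n : nat) : Prop :=
  exists P : nat -> set R,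
    (forall i, (i <= n)%N -> is_prime_ideal (P i)) /\
    (forall i, (i < n)%N -> P i `<` P i.+1).

Definition krull_dim (d : nat) : Prop :=
  prime_chain d /\ forall n, prime_chain n -> (n <= d)%N.

Definition min_number_generators I (d : nat) : Prop :=
  (exists s : seq R, size s = d /\ I = ideal_gen [set` s]) /\
  (forall s : seq R, I = ideal_gen [set` s] -> (d <= size s)%N).

Definition is_local_with M : Prop :=
  is_maximal_ideal M /\ forall M', is_maximal_ideal M' -> M' = M.

Definition regular_local : Prop :=
  noetherian /\
  exists M, is_local_with M /\
    exists d, krull_dim d /\ min_number_generators M d.

End Ideals.

Arguments noetherian R : clear implicits.
Arguments regular_local R : clear implicits.

Record prime_ideal (R : comPzRingType) := PrimeIdeal {
  prime_set :> set R;
  prime_idealP : is_prime_ideal prime_set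
}.

Module Localization.
Section Localization.
Variables (R : comPzRingType) (P : prime_ideal R).

Lemma out1 : (~` P) 1.
Proof. by case: (prime_idealP P). Qed.

Lemma outM a b : (~` P) a -> (~` P) b -> (~` P) (a * b).
Proof. by case: (prime_idealP P) => _ _ H Pa Pb /H[]. Qed.

Record frac := Frac { num : R; den : R; denP : `[< (~` P) den >] }.

Definition pair_of_frac (x : frac) : R * R := (num x, den x).
Definition frac_of_pair (x : R * R) : option frac :=
  match @idP `[< (~` P) x.2 >] with
  | ReflectT h => Some (@Frac x.1 x.2 h)
  | ReflectF _ => None
  end.

Lemma pair_of_fracK : pcancel pair_of_frac frac_of_pair.
Proof.
case=> a s h; rewrite /frac_of_pair /pair_of_frac /=.
by case: {-}_ / idP => // h'; rewrite (bool_irrelevance h' h).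
Qed.

HB.instance Definition _ := Choice.copy frac (pcan_type pair_of_fracK).

Definition mkfrac (a s : R) (h : (~` P) s) : frac := @Frac a s (asboolT h).

Lemma den_out (x : frac) : (~` P) (den x).
Proof. by case: x => a s h; apply/asboolP. Qed.
Arguments den_out : clear implicits.

(* R need not be a domain, hence the factor u. *)
Definition equivf (x y : frac) : bool :=
  `[< exists2 u, (~` P) u & u * (num x * den y - num y * den x) = 0 >].

Lemma equivf_refl : reflexive equivf.
Proof. by move=> x; apply/asboolP; exists 1; [exact: out1|rewrite subrr mulr0]. Qed.

Lemma equivf_symi x y : equivf x y -> equivf y x.
Proof.
move=> /asboolP[u Pu e]; apply/asboolP; exists u => //.
by rewrite -[LHS]opprK -mulrN opprB e oppr0.
Qed.

Lemma equivf_sym : symmetric equivf.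
Proof. by move=> x y; apply/idP/idP; apply: equivf_symi. Qed.

Lemma equivf_trans : transitive equivf.
Proof.
move=> y x z /asboolP[u Pu e] /asboolP[v Pv f]; apply/asboolP.
exists (u * v * den y); first exact: outM (outM Pu Pv) (den_out y).
transitivity (v * den z * (u * (num x * den y - num y * den x))
  + u * den x * (v * (num y * den z - num z * den y))); first by ring.
by rewrite e f !mulr0 addr0.
Qed.

Canonical equivf_equiv := EquivRel equivf equivf_refl equivf_sym equivf_trans.

Definition type := {eq_quot equivf}.

HB.instance Definition _ : EqQuotient _ equivf type := EqQuotient.on type.
HB.instance Definition _ := Choice.on type.

Definition mk (a s : R) (h : (~` P) s) : type := \pi_type (mkfrac a h).

Lemma equivfP (x y : frac) :
  reflect (exists2 u, (~` P) u & u * (num x * den y - num y * den x) = 0)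
          (\pi_type x == \pi_type y).
Proof. by rewrite eqmodE; apply: asboolP. Qed.

Lemma equiv_repr (x : frac) : exists2 u, (~` P) u &
  u * (num (repr (\pi_type x)) * den x - num x * den (repr (\pi_type x))) = 0.
Proof. by apply/equivfP; rewrite reprK. Qed.

Definition fadd (x y : frac) : frac :=
  mkfrac (num x * den y + num y * den x) (outM (den_out x) (den_out y)).
Definition fopp (x : frac) : frac := mkfrac (- num x) (den_out x).
Definition fmul (x y : frac) : frac :=
  mkfrac (num x * num y) (outM (den_out x) (den_out y)).

Definition zero : type := mk 0 out1.
Definition one : type := mk 1 out1.
Definition add (x y : type) : type := \pi_type (fadd (repr x) (repr y)).
Definition opp (x : type) : type := \pi_type (fopp (repr x)).
Definition mul (x y : type) : type := \pi_type (fmul (repr x) (repr y)).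

Lemma pi_add x y : add (\pi_type x) (\pi_type y) = \pi_type (fadd x y).
Proof.
apply/eqP/equivfP; have [u Pu eu] := equiv_repr x; have [v Pv ev] := equiv_repr y.
move: (repr (\pi_type x)) (repr (\pi_type y)) eu ev => x' y' eu ev /=.
exists (u * v); first exact: outM.
transitivity (v * den y * den y' * (u * (num x' * den x - num x * den x'))
  + u * den x * den x' * (v * (num y' * den y - num y * den y'))); first by ring.
by rewrite eu ev !mulr0 addr0.
Qed.

Lemma pi_opp x : opp (\pi_type x) = \pi_type (fopp x).
Proof.
apply/eqP/equivfP; have [u Pu eu] := equiv_repr x.
move: (repr _) eu => x' eu /=; exists u => //.
transitivity (- (u * (num x' * den x - num x * den x'))); first by ring.
by rewrite eu oppr0.
Qed.

Lemma pi_mul x y : mul (\pi_type x) (\pi_type y) = \pi_type (fmul x y).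
Proof.
apply/eqP/equivfP; have [u Pu eu] := equiv_repr x; have [v Pv ev] := equiv_repr y.
move: (repr (\pi_type x)) (repr (\pi_type y)) eu ev => x' y' eu ev /=.
exists (u * v); first exact: outM.
transitivity (v * num y' * den y * (u * (num x' * den x - num x * den x'))
  + u * num x * den x' * (v * (num y' * den y - num y * den y'))); first by ring.
by rewrite eu ev !mulr0 addr0.
Qed.

Lemma pi_eq (x y : frac) :
  num x * den y = num y * den x -> \pi_type x = \pi_type y.
Proof.
move=> e; apply/eqP/equivfP; exists 1; first exact: out1.
by rewrite e subrr mulr0.
Qed.

Lemma addA : associative add.
Proof.
elim/quotW=> x; elim/quotW=> y; elim/quotW=> z.
by rewrite (pi_add y z) (pi_add x y) !pi_add; apply: pi_eq => /=; ring.
Qed.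

Lemma addC : commutative add.
Proof.
by elim/quotW=> x; elim/quotW=> y; rewrite !pi_add; apply: pi_eq => /=; ring.
Qed.

Lemma add0 : left_id zero add.
Proof. by elim/quotW=> x; rewrite pi_add; apply: pi_eq => /=; ring. Qed.

Lemma addN : left_inverse zero opp add.
Proof. by elim/quotW=> x; rewrite (pi_opp x) pi_add; apply: pi_eq => /=; ring. Qed.

HB.instance Definition _ := GRing.isZmodule.Build type addA addC add0 addN.

Lemma mulA : associative mul.
Proof.
elim/quotW=> x; elim/quotW=> y; elim/quotW=> z.
by rewrite (pi_mul y z) (pi_mul x y) !pi_mul; apply: pi_eq => /=; ring.
Qed.

Lemma mulC : commutative mul.
Proof.
by elim/quotW=> x; elim/quotW=> y; rewrite !pi_mul; apply: pi_eq => /=; ring.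
Qed.

Lemma mul1 : left_id one mul.
Proof. by elim/quotW=> x; rewrite pi_mul; apply: pi_eq => /=; ring. Qed.

Lemma mulDl : left_distributive mul add.
Proof.
elim/quotW=> x; elim/quotW=> y; elim/quotW=> z.
rewrite (pi_add x y) (pi_mul x z) (pi_mul y z) pi_mul pi_add.
by apply: pi_eq => /=; ring.
Qed.

HB.instance Definition _ := GRing.Zmodule_isComPzRing.Build type mulA mulC mul1 mulDl.

End Localization.
End Localization.
HB.export Localization.

Definition localization (R : comPzRingType) (P : prime_ideal R) : comPzRingType :=
  Localization.type P.

Definition regular_ring (R : comPzRingType) : Prop :=
  noetherian R /\ forall P : prime_ideal R, regular_local (localization P).

(* Main.v *)
(* Kunz's theorem, by lengths.  Call (C) the condition (I^[q] : x^q) = (I : x)^[q]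
   for all ideals I and all x.  By the Artin-Rees lemma and Krull's intersection
   theorem, (C) only has to be checked for ideals containing a power of a maximal
   ideal; it passes to localizations and can be checked on them.  It implies
   (2), because it gives (A cap B)^[q] = A^[q] cap B^[q].

   Let (R, M) be Noetherian local with M generated by d elements and no fewer.
   The dimension of R is the order of growth of length(R/M^N) in N, and
   R is regular iff length(R/M^[q]) = q^d for all q.
   If (C) holds then x_1^q, ..., x_d^q are independent in the sense of Lech, so
   length(R/M^[q]) = q^d and R has dimension d.  Conversely, filtering gives
   length(R/I^[q]) <= length(R/M^[q]) length(R/I); if R is regular, growth forces
   length(R/M^[q]) = q^d, and comparing I with M^[Q] inside I turns the
   inequality into an equality, from which (C) follows by counting lengths
   in 0 -> R/(I : x) -> R/I -> R/(I + x) -> 0. *)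

Require Import Defs.
From HB Require Import structures.
From mathcomp Require Import all_boot all_order all_algebra.
From mathcomp Require Import boolp classical_sets.
From mathcomp Require Import ring zify.

Set Implicit Arguments.
Unset Strict Implicit.
Unset Printing Implicit Defensive.

Import GRing.Theory.
Local Open Scope classical_set_scope.
Local Open Scope ring_scope.

(** * Ideals of Noetherian rings *)

Section Ideals.
Variable R : comPzRingType.
Implicit Types (I J K P M B : set R) (x y z r a b : R).

(** Everything is done with ideals alone: I is compared with I + Rx and (I : x), whose colengths add
    up to that of I, and this identity stands in for modules and for the flatness of Frobenius.
    Dimension is not developed as a theory either: a chain of primes forces growth from below, and
    growth too fast for order n forces a chain of primes with n + 1 strict steps. Two forms of the
    Artin-Rees lemma appear because the two uses differ. Reducing (C) to ideals that contain a power
    of M asks only for some exponent N' for each N, and ascending chains suffice for that. The lower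
    bound on growth sums over exponents and would lose its order if N' were not N plus a constant;
    that form goes through the Rees algebra and Hilbert's basis theorem. In passing from (C) to
    regularity, q is chosen after the constant of a supposed growth bound, and this is where (C) is
    used for large q. *)

Lemma ideal0 I : is_ideal I -> I 0. Proof. by case. Qed.

Lemma idealD I a b : is_ideal I -> I a -> I b -> I (a + b).
Proof. by case=> _ + _; apply. Qed.

Lemma idealMl I r a : is_ideal I -> I a -> I (r * a).
Proof. by case=> _ _; apply. Qed.

Lemma idealMr I r a : is_ideal I -> I a -> I (a * r).
Proof. by move=> hI Ia; rewrite mulrC; apply: idealMl. Qed.

Lemma idealN I a : is_ideal I -> I a -> I (- a).
Proof. by move=> hI Ia; rewrite -mulN1r; apply: idealMl. Qed.

Lemma idealB I a b : is_ideal I -> I a -> I b -> I (a - b).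
Proof. by move=> hI Ia Ib; apply: idealD => //; apply: idealN. Qed.

Lemma idealBD I a b : is_ideal I -> I (a - b) -> I b -> I a.
Proof. by move=> hI Iab Ib; rewrite -(subrK b a); apply: idealD. Qed.

Lemma idealX I a n : is_ideal I -> (0 < n)%N -> I a -> I (a ^+ n).
Proof. by case: n => // n hI _ Ia; rewrite exprS; apply: idealMr. Qed.

Lemma ideal_sum (T : Type) I (s : seq T) (Q : pred T) (F : T -> R) :
  is_ideal I -> (forall i, Q i -> I (F i)) -> I (\sum_(i <- s | Q i) F i).
Proof.
move=> hI IF; elim/big_ind: _ => //; first exact: ideal0.
by move=> *; apply: idealD.
Qed.

Lemma ideal1 I : is_ideal I -> I 1 -> I = setT.
Proof.
by move=> hI I1; apply/seteqP; split=> // x _; rewrite -[x]mulr1; apply: idealMl.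
Qed.

Lemma setT_ideal : is_ideal (@setT R). Proof. by []. Qed.

Lemma ideal_gen_ideal (S : set R) : is_ideal (ideal_gen S).
Proof.
split=> [I [hI _]|a b Sa Sb I hI|r a Sa I hI]; first exact: ideal0.
- by apply: idealD; [case: hI|apply: Sa|apply: Sb].
- by apply: idealMl; [case: hI|apply: Sa].
Qed.

Lemma ideal_gen_sub (S : set R) I :
  is_ideal I -> S `<=` I -> ideal_gen S `<=` I.
Proof. exact: smallest_sub. Qed.

Lemma sub_ideal_gen (S : set R) : S `<=` ideal_gen S.
Proof. exact: sub_gen_smallest. Qed.

Lemma colon_elt_ideal I x : is_ideal I -> is_ideal (colon_elt I x).
Proof.
move=> hI; rewrite /colon_elt; split=> /=; first by rewrite mul0r; apply: ideal0.
- by move=> a b Ia Ib; rewrite mulrDl; apply: idealD.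
- by move=> r a Ia; rewrite -mulrA; apply: idealMl.
Qed.

Lemma sub_colon_elt I x : is_ideal I -> I `<=` colon_elt I x.
Proof. by move=> hI a Ia; apply: idealMr. Qed.

Lemma colon_elt_mono I J x : I `<=` J -> colon_elt I x `<=` colon_elt J x.
Proof. by move=> IJ a /= /IJ. Qed.

Lemma colon_ideal I J : is_ideal I -> is_ideal (colon I J).
Proof.
move=> hI; split=> [y _|a b Ia Ib y Jy|r a Ia y Jy].
- by rewrite mul0r; apply: ideal0.
- by rewrite mulrDl; apply: idealD; [|apply: Ia|apply: Ib].
- by rewrite -mulrA; apply: idealMl => //; apply: Ia.
Qed.

Definition adjoin I x : set R := [set z | exists r, I (z - r * x)].

Lemma adjoin_ideal I x : is_ideal I -> is_ideal (adjoin I x).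
Proof.
move=> hI; split.
- by exists 0; rewrite mul0r subrr; apply: ideal0.
- move=> a b [r Ia] [s Ib]; exists (r + s).
  have -> : a + b - (r + s) * x = (a - r * x) + (b - s * x) by ring.
  exact: idealD.
- move=> r a [s Ia]; exists (r * s); rewrite -mulrA -mulrBr; exact: idealMl.
Qed.

Lemma sub_adjoin I x : I `<=` adjoin I x.
Proof. by move=> a Ia; exists 0; rewrite mul0r subr0. Qed.

Lemma mem_adjoin I x : is_ideal I -> adjoin I x x.
Proof. by move=> hI; exists 1; rewrite mul1r subrr; apply: ideal0. Qed.

Lemma adjoin_sub I J x : is_ideal J -> I `<=` J -> J x -> adjoin I x `<=` J.
Proof.
move=> hJ IJ Jx z [r /IJ Jz]; apply: idealBD Jz _ => //; exact: idealMl.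
Qed.

Lemma adjoin_mono I J x : I `<=` J -> adjoin I x `<=` adjoin J x.
Proof. by move=> IJ z [r /IJ]; exists r. Qed.

Lemma proper_adjoin I x : is_ideal I -> ~ I x -> I `<` adjoin I x.
Proof.
by move=> hI nIx; split; [exact: sub_adjoin|move=> /(_ x (mem_adjoin x hI))].
Qed.

Definition ideal_add I J : set R := [set z | exists2 a, I a & J (z - a)].

Lemma ideal_add_ideal I J : is_ideal I -> is_ideal J -> is_ideal (ideal_add I J).
Proof.
move=> hI hJ; split.
- by exists 0; [|rewrite subrr]; apply: ideal0.
- move=> a b [c Ic Ja] [d Id Jb]; exists (c + d); first exact: idealD.
  have -> : a + b - (c + d) = (a - c) + (b - d) by ring.
  exact: idealD.
- move=> r a [c Ic Ja]; exists (r * c); first exact: idealMl.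
  by rewrite -mulrBr; apply: idealMl.
Qed.

Lemma ideal_addl I J : is_ideal J -> I `<=` ideal_add I J.
Proof. by move=> hJ a Ia; exists a => //; rewrite subrr; apply: ideal0. Qed.

Lemma ideal_addr I J : is_ideal I -> J `<=` ideal_add I J.
Proof. by move=> hI a Ja; exists 0; [apply: ideal0|rewrite subr0]. Qed.

Lemma ideal_add_sub I J K :
  is_ideal K -> I `<=` K -> J `<=` K -> ideal_add I J `<=` K.
Proof. by move=> hK IK JK z [a /IK Ka /JK Kz]; apply: idealBD Kz _. Qed.

Lemma ideal_add_mono I I' J J' :
  I `<=` I' -> J `<=` J' -> ideal_add I J `<=` ideal_add I' J'.
Proof. by move=> II JJ z [a /II Ia /JJ Ja]; exists a. Qed.

Lemma adjoin_add I J x : is_ideal I -> is_ideal J ->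
  adjoin (ideal_add I J) x = ideal_add (adjoin I x) J.
Proof.
move=> hI hJ; have hA := adjoin_ideal x hI; apply/seteqP; split.
  apply: adjoin_sub; first exact: ideal_add_ideal.
  - exact: ideal_add_mono (sub_adjoin _) _.
  - by apply: ideal_addl => //; exact: mem_adjoin.
apply: ideal_add_sub; first by apply: adjoin_ideal; apply: ideal_add_ideal.
- by apply: adjoin_mono; apply: ideal_addl.
- by apply: subset_trans (sub_adjoin _); apply: ideal_addr.
Qed.

Fixpoint idpow M (n : nat) : set R :=
  if n is n'.+1 then ideal_gen [set a * b | a in M & b in idpow M n'] else setT.

Lemma idpow_ideal M n : is_ideal (idpow M n).
Proof. by case: n => //= n; apply: ideal_gen_ideal. Qed.

Lemma idpowS_mem M n a b : M a -> idpow M n b -> idpow M n.+1 (a * b).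
Proof. by move=> Ma Mb; apply: sub_ideal_gen; exists a => //; exists b. Qed.

Lemma idpowS_sub M n I : is_ideal I ->
  (forall a b, M a -> idpow M n b -> I (a * b)) -> idpow M n.+1 `<=` I.
Proof.
move=> hI H; apply: ideal_gen_sub => // _ [a Ma [b Mb <-]]; exact: H.
Qed.

Lemma idpow_le M m n : (m <= n)%N -> idpow M n `<=` idpow M m.
Proof.
elim: n m => [|n IHn] [|m] //= mn; apply: idpowS_sub => [|a b Ma Mb].
  exact: (idpow_ideal M m.+1).
by apply: idpowS_mem => //; apply: IHn Mb.
Qed.

Lemma idpowD M m n a b : idpow M m a -> idpow M n b -> idpow M (m + n) (a * b).
Proof.
elim: m a b => [|m IHm] a b Ma Mb.
  by apply: idealMl => //; apply: idpow_ideal.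
suff : idpow M m.+1 `<=` colon_elt (idpow M (m + n).+1) b by apply.
apply: idpowS_sub; first by apply: colon_elt_ideal; apply: idpow_ideal.
by move=> c d Mc Md; rewrite /colon_elt /= -mulrA; apply: idpowS_mem => //; apply: IHm.
Qed.

Lemma idpow_expr M n a : M a -> idpow M n (a ^+ n).
Proof.
move=> Ma; elim: n => // n IHn; rewrite exprS; exact: idpowS_mem.
Qed.

Lemma idpow1 M : is_ideal M -> idpow M 1 = M.
Proof.
move=> hM; apply/seteqP; split.
  by apply: idpowS_sub => // a b Ma _; apply: idealMr.
by move=> a Ma; rewrite -[a]mulr1; apply: idpowS_mem.
Qed.

Lemma idpow_sub M n : is_ideal M -> (0 < n)%N -> idpow M n `<=` M.
Proof. by move=> hM n0; rewrite -[X in _ `<=` X]idpow1 //; apply: idpow_le. Qed.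

(** Generators are an indexed family rather than a sequence, so that one of them can be replaced in
    place and each can carry its own exponent. *)
Definition fspan n (f : 'I_n -> R) : set R :=
  [set z | exists c : 'I_n -> R, z = \sum_i c i * f i].

Lemma span_ideal n (f : 'I_n -> R) : is_ideal (fspan f).
Proof.
split.
- by exists (fun=> 0); rewrite big1 // => i _; rewrite mul0r.
- move=> a b [c ->] [d ->]; exists (fun i => c i + d i).
  by rewrite -big_split; apply: eq_bigr => i _; rewrite mulrDl.
- move=> r a [c ->]; exists (fun i => r * c i).
  by rewrite mulr_sumr; apply: eq_bigr => i _; rewrite mulrA.
Qed.

Lemma mem_span n (f : 'I_n -> R) i : fspan f (f i).
Proof.
exists (fun j => (j == i)%:R); rewrite (bigD1 i) //= eqxx mul1r big1 ?addr0 //.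
by move=> j /negbTE ->; rewrite mul0r.
Qed.

Lemma span_sub n (f : 'I_n -> R) I :
  is_ideal I -> (forall i, I (f i)) -> fspan f `<=` I.
Proof.
by move=> hI If z [c ->]; apply: ideal_sum => // i _; apply: idealMl.
Qed.

Lemma span_gen n (f : 'I_n -> R) : fspan f = ideal_gen (range f).
Proof.
apply/seteqP; split.
  apply: span_sub; first exact: ideal_gen_ideal.
  by move=> i; apply: sub_ideal_gen; exists i.
by apply: ideal_gen_sub; [exact: span_ideal|move=> _ [i _ <-]; apply: mem_span].
Qed.

Lemma gen_seq_span (s : seq R) :
  ideal_gen [set` s] = fspan (fun i : 'I_(size s) => s`_i).
Proof.
rewrite span_gen; congr ideal_gen; apply/seteqP; split=> [x /= xs|_ [i _ <-] /=].
  have lt : (index x s < size s)%N by rewrite index_mem.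
  by exists (Ordinal lt) => //=; rewrite nth_index.
exact: mem_nth.
Qed.

(* Induction on the sum of the exponents, dividing I by one generator. *)
Lemma idpow_span_sub n (t : 'I_n -> R) (N : 'I_n -> nat) I : is_ideal I ->
  (forall i, I (t i ^+ N i)) -> idpow (fspan t) (\sum_i N i).+1 `<=` I.
Proof.
have [m] := ubnP (\sum_i N i); elim: m N I => // m IHm N I leNm hI It.
have [[i Ni0]|N0] := pselect (exists i, N i = 0%N).
  by rewrite (ideal1 hI) //; move: (It i); rewrite Ni0.
apply: idpowS_sub => // a b ta tb.
suff : fspan t `<=` colon_elt I b by move/(_ a ta).
apply: span_sub; first exact: colon_elt_ideal.
move=> i; pose N' j := if j == i then (N i).-1 else N j.
have Ni0 : (0 < N i)%N by rewrite lt0n; apply/eqP => h; apply: N0; exists i.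
have sN : (\sum_j N j = (\sum_j N' j).+1)%N.
  rewrite (bigD1 i) //= [in RHS](bigD1 i) //= {1}/N' eqxx -addSn prednK //.
  by congr addn; apply: eq_bigr => j /negbTE; rewrite /N' => ->.
suff sI : idpow (fspan t) (\sum_j N' j).+1 `<=` colon_elt I (t i).
  by rewrite /colon_elt /= mulrC; apply: sI; rewrite -sN.
apply: IHm; [by rewrite -ltnS -sN | exact: colon_elt_ideal |].
move=> j; rewrite /N' /colon_elt /=; case: eqP => [->|_].
  by rewrite -exprSr prednK.
by apply: idealMr.
Qed.

End Ideals.

(** * Ascending chains, maximal elements and Noetherian induction *)

Section Noetherian.
Variable R : comPzRingType.
Implicit Types (I J K P M B : set R).
Hypothesis nR : noetherian R.

Lemma noetherian_acc (F : nat -> set R) : (forall i, is_ideal (F i)) ->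
  (forall i, F i `<=` F i.+1) -> exists n, forall m, (n <= m)%N -> F m = F n.
Proof.
move=> hF FS; have Fle i j : (i <= j)%N -> F i `<=` F j.
  elim: j => [|j IHj]; first by rewrite leqn0 => /eqP ->.
  rewrite leq_eqVlt => /orP[/eqP -> //|]; rewrite ltnS => /IHj h.
  exact: subset_trans h (FS j).
pose U := [set z | exists i, F i z].
have hU : is_ideal U.
  split; first by exists 0%N; apply: ideal0.
  - move=> a b [i Fa] [j Fb]; exists (maxn i j).
    by apply: idealD; [|apply: Fle Fa; exact: leq_maxl|apply: Fle Fb; exact: leq_maxr].
  - by move=> r a [i Fa]; exists i; apply: idealMl.
have [s sU] := nR hU.
have [n Fs] : exists n, forall x, x \in s -> F n x.
  have : forall x, x \in s -> U x by move=> x xs; rewrite sU; apply: sub_ideal_gen.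
  elim: s {sU} => [|x s IHs] Us; first by exists 0%N.
  have [|n Fn] := IHs; first by move=> y ys; apply: Us; rewrite in_cons ys orbT.
  have [|m Fm] := Us x; first exact: mem_head.
  exists (maxn n m) => y; rewrite in_cons => /orP[/eqP ->|/Fn].
    by apply: Fle Fm; exact: leq_maxr.
  by apply: Fle; exact: leq_maxl.
exists n => m nm; apply/seteqP; split; last exact: Fle.
apply: (@subset_trans _ U); first by move=> z Fz; exists m.
by rewrite sU; apply: ideal_gen_sub.
Qed.

(** If no member above I were maximal, repeated choice would give a strictly ascending chain of
    ideals, against [noetherian_acc]. *)
Lemma noetherian_max (F : set (set R)) I : F `<=` @is_ideal R -> F I ->
  exists J, [/\ F J, I `<=` J & forall K, F K -> J `<` K -> False].
Proof.
move=> hF FI; apply: contrapT => noJ.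
have nxt (J : {J | F J /\ I `<=` J}) :
    exists K : {J | F J /\ I `<=` J}, sval J `<` sval K.
  case: J => J [FJ IJ] /=; apply: contrapT => noK; apply: noJ; exists J; split=> // K FK JK.
  apply: noK; exists (exist _ K (conj FK (subset_trans IJ (proj1 JK)))); exact: JK.
have [g gP] := choice nxt.
pose G n := iter n g (exist _ I (conj FI (@subset_refl _ I))).
have [||n /(_ n.+1 (leqnSn n)) /esym e] := @noetherian_acc (fun n => sval (G n)).
- by move=> i; apply: hF; case: (svalP (G i)).
- by move=> i; case: (gP (G i)).
- by have [_] := gP (G n); apply; rewrite -[X in X `<=` _]/(sval (G n.+1)) -e.
Qed.

Lemma noetherian_ind (Q : set R -> Prop) :
  (forall I, is_ideal I -> (forall J, is_ideal J -> I `<` J -> Q J) -> Q I) ->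
  forall I, is_ideal I -> Q I.
Proof.
move=> H I hI; apply: contrapT => nQ.
have [//|J [[hJ nQJ] _ maxJ]] := @noetherian_max [set J | is_ideal J /\ ~ Q J] I _ (conj hI nQ).
  by move=> J [].
apply: nQJ; apply: H => // K hK JK; apply: contrapT => nQK; exact: maxJ JK.
Qed.

Lemma exists_maximal I : is_ideal I -> ~ I 1 ->
  exists2 M, is_maximal_ideal M & I `<=` M.
Proof.
move=> hI I1; have [|M [[hM M1] IM maxM]] :=
  @noetherian_max [set J | is_ideal J /\ ~ J 1] I _ (conj hI I1).
  by move=> J [].
exists M => //; split=> // J hJ MJ; have [J1|nJ1] := pselect (J 1).
  by right; apply: ideal1.
left; apply: contrapT => JM; apply: (maxM J) => //; rewrite properEneq; split=> //.
by apply/eqP => e; apply: JM.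
Qed.

Lemma noetherian_span I : is_ideal I ->
  exists n, exists f : 'I_n -> R, I = fspan f.
Proof. by move=> /nR[s ->]; rewrite gen_seq_span; exists (size s); eexists. Qed.

Lemma exists_min_number_generators I : is_ideal I -> exists d, min_number_generators I d.
Proof.
move=> /nR[s0 es0].
have ex : exists d, `[< exists s : seq R, size s = d /\ I = ideal_gen [set` s] >].
  by exists (size s0); apply/asboolP; exists s0.
case: (ex_minnP ex) => d /asboolP sd dmin; exists d; split=> // s es.
by apply: dmin; apply/asboolP; exists s.
Qed.

End Noetherian.

(** * Maximal ideals and the ideals containing one of their powers *)

Section MaximalIdeals.
Variable R : comPzRingType.
Implicit Types (I J K P M : set R).

Lemma maximal_unit_mod M x : is_maximal_ideal M -> ~ M x -> exists r, M (1 - r * x).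
Proof.
move=> [hM M1 maxM] Mx; have [|e|e] := maxM _ (adjoin_ideal x hM).
- exact: sub_adjoin.
- by case: Mx; rewrite -e; apply: mem_adjoin.
- by have : adjoin M x 1 by rewrite e.
Qed.

Lemma maximal_prime M : is_maximal_ideal M -> is_prime_ideal M.
Proof.
move=> mM; have [hM M1 _] := mM; split=> // a b Mab.
have [Ma|nMa] := pselect (M a); [by left|right].
have [r Mr] := maximal_unit_mod mM nMa.
have -> : b = b * (1 - r * a) + r * (a * b) by ring.
by apply: idealD => //; apply: idealMl.
Qed.

Lemma prime_exp P a n : is_prime_ideal P -> P (a ^+ n) -> P a.
Proof.
move=> [_ P1 Pm]; elim: n => [//|n IHn]; rewrite exprS => /Pm[//|]; exact: IHn.
Qed.

Lemma one_sub_mem_exp I n m : is_ideal I -> I m -> I (1 - (1 - m) ^+ n).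
Proof.
move=> hI Im; elim: n => [|n IHn]; first by rewrite expr0 subrr; apply: ideal0.
rewrite exprS; have -> : 1 - (1 - m) * (1 - m) ^+ n = (1 - (1 - m) ^+ n) + m * (1 - m) ^+ n by ring.
by apply: idealD => //; apply: idealMr.
Qed.

(* Expanding [1 = (m + r x)^n] with [m \in M]. *)
Lemma maximal_unit_mod_pow M x n : is_maximal_ideal M -> ~ M x ->
  exists r, idpow M n (1 - r * x).
Proof.
move=> mM Mx; have [r Mr] := maximal_unit_mod mM Mx.
have hA := adjoin_ideal x (idpow_ideal M n).
suff [s Ms] : adjoin (idpow M n) x 1 by exists s.
apply: (idealBD hA (b := (1 - r * x) ^+ n)); last first.
  by apply: sub_adjoin; apply: idpow_expr.
apply: one_sub_mem_exp => //; apply: idealMl => //; apply: mem_adjoin.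
exact: idpow_ideal.
Qed.

(** Elements outside M are units modulo M^n, hence modulo a. This is the bridge from ideals
    containing a power of M, which the reduction produces, to the primary ideals of condition
    (3). *)
Lemma pow_sub_primary M n a : is_maximal_ideal M -> is_ideal a -> ~ a 1 ->
  idpow M n `<=` a -> is_primary_to a M.
Proof.
move=> mM ha a1 Ma; have [hM M1 _] := mM.
have aM : a `<=` M.
  move=> y ay; apply: contrapT => nMy; have [r Mr] := maximal_unit_mod_pow n mM nMy.
  by apply: a1; apply: (idealBD ha (Ma _ Mr)); apply: idealMl.
have rM : radical a = M.
  apply/seteqP; split=> [y [k /aM]|y My]; first exact: prime_exp (maximal_prime mM).
  by exists n; apply: Ma; apply: idpow_expr.
split=> //; split=> // x y axy; rewrite rM; have [My|nMy] := pselect (M y); [by right|left].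
have [r Mr] := maximal_unit_mod_pow n mM nMy.
have -> : x = x * (1 - r * y) + r * (x * y) by ring.
by apply: idealD => //; apply: idealMl => //; apply: Ma.
Qed.

End MaximalIdeals.

(** * Lengths *)

Section Length.
Variable R : comPzRingType.
Implicit Types (I J K P M B : set R) (x y z r a b : R).

(* [len_ge n I] and [len_le n I] say that R/I has length at least, at most n,
   length being the supremum of the lengths of strict chains of ideals. *)
Inductive len_ge : nat -> set R -> Prop :=
| len_ge0 I : len_ge 0 I
| len_geS n I J : is_ideal J -> I `<` J -> len_ge n J -> len_ge n.+1 I.

Definition len_le n I := forall k, len_ge k I -> (k <= n)%N.

Lemma len_ge_mono n I J : I `<=` J -> len_ge n J -> len_ge n I.
Proof.
move=> IJ h; case: h IJ => [K _|k K L hL KL h IK]; first exact: len_ge0.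
apply: len_geS h => //; have [IL nLK] := KL; split; first exact: subset_trans IL.
by move=> LI; apply: nLK; apply: subset_trans IK.
Qed.

Lemma len_ge_leq m n I : (m <= n)%N -> len_ge n I -> len_ge m I.
Proof.
move=> + h; elim: h m => [K|k K L hL KL h IH] [|m] //; try by move=> *; exact: len_ge0.
by rewrite ltnS => /IH; apply: len_geS.
Qed.

Lemma len_le_mono n I J : I `<=` J -> len_le n I -> len_le n J.
Proof. by move=> IJ h k /(len_ge_mono IJ); apply: h. Qed.

Lemma len_le_leq m n I : (m <= n)%N -> len_le m I -> len_le n I.
Proof. by move=> mn h k /h km; apply: leq_trans mn. Qed.

Lemma len_le_setT n : len_le n [set: R].
Proof.
move=> k h; suff -> : k = 0%N by [].
move: h; set T := [set: R] => h; have : T = setT by [].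
by case: h => // ? I J _ [_ JI] _ e; case: JI; rewrite e.
Qed.

Lemma proper_len_ge n I J : is_ideal J -> I `<=` J -> len_ge n J -> I <> J ->
  len_ge n.+1 I.
Proof.
move=> hJ IJ h nIJ; apply: len_geS h => //; split=> // JI; apply: nIJ.
exact/seteqP.
Qed.

(** Modulo I, an element of J is a multiple r x, and then r lies in (J : x) = (I : x). Hence a
    strict inclusion stays strict for at least one of I + Rx and (I : x). *)
Lemma eq_adjoin_colon I J x : is_ideal I -> I `<=` J -> is_ideal J ->
  adjoin I x = adjoin J x -> colon_elt I x = colon_elt J x -> I = J.
Proof.
move=> hI IJ hJ eA eC; apply/seteqP; split=> // z Jz.
have [r Iz] : adjoin I x z by rewrite eA; exact: sub_adjoin.
apply: (idealBD hI Iz); have : colon_elt J x r.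
  by rewrite /colon_elt /= -[r * x](subKr z); apply: idealB => //; apply: IJ.
by rewrite -eC.
Qed.

(** Each strict step of a chain above I remains strict after adjoining x or after taking the colon
    by x, so its steps are shared out between two chains. *)
Lemma len_ge_split n I x : is_ideal I -> len_ge n I ->
  exists i j, [/\ (n <= i + j)%N, len_ge i (adjoin I x) & len_ge j (colon_elt I x)].
Proof.
move=> + h; elim: h => {n I} [I _|n I J hJ [IJ nJI] h IHh hI].
  by exists 0%N, 0%N; split=> //; exact: len_ge0.
have [i [j [nij hi hj]]] := IHh hJ.
have [eA|neA] := pselect (adjoin I x = adjoin J x); last first.
  exists i.+1, j; split; first by rewrite addSn ltnS.
    apply: proper_len_ge hi neA; [exact: adjoin_ideal|exact: adjoin_mono].
  by apply: len_ge_mono hj; apply: colon_elt_mono.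
exists i, j.+1; split; first by rewrite addnS ltnS.
  by rewrite eA.
apply: proper_len_ge hj _; [exact: colon_elt_ideal|exact: colon_elt_mono|].
by move=> eC; apply: nJI; rewrite (eq_adjoin_colon hI IJ hJ eA eC).
Qed.

Lemma len_le_add i j I x : is_ideal I ->
  len_le i (adjoin I x) -> len_le j (colon_elt I x) -> len_le (i + j) I.
Proof.
move=> hI hi hj k /(len_ge_split x hI)[i' [j' [kij /hi ii /hj jj]]].
exact: leq_trans kij (leq_add ii jj).
Qed.

(** Ideals D containing (I : x) correspond to the ideals [E D] = I + Dx between I and I + Rx; a
    chain above (I : x) is carried there and continued by the chain above I + Rx. *)
Lemma len_ge_add i j I x : is_ideal I ->
  len_ge i (adjoin I x) -> len_ge j (colon_elt I x) -> len_ge (i + j) I.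
Proof.
move=> hI hi hj.
pose E D := [set z | exists2 d, D d & I (z - d * x)] : set R.
have hE D : is_ideal D -> is_ideal (E D).
  move=> hD; split.
  - by exists 0; [|rewrite mul0r subrr]; apply: ideal0.
  - move=> a b [c Dc Ia] [d Dd Ib]; exists (c + d); first exact: idealD.
    by rewrite mulrDl opprD addrACA; apply: idealD.
  - move=> r a [c Dc Ia]; exists (r * c); first exact: idealMl.
    by rewrite -mulrA -mulrBr; apply: idealMl.
suff H D : is_ideal D -> colon_elt I x `<=` D -> len_ge j D -> len_ge (i + j) (E D).
  apply: len_ge_mono (H _ (colon_elt_ideal x hI) (@subset_refl _ _) hj).
  by move=> z Iz; exists 0; [apply: ideal0; apply: colon_elt_ideal|rewrite mul0r subr0].
move=> + + h; elim: h => {hj j D} [D|n D D' hD' [DD' nDD'] h IHh] hD CD.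
  by rewrite addn0; apply: len_ge_mono hi => z [d _ Iz]; exists d.
rewrite addnS; apply: (@len_geS _ _ (E D')); [exact: hE| |]; last first.
  by apply: IHh => //; apply: subset_trans DD'.
split=> [z [d Dd Iz]|sub]; first by exists d => //; exact: DD'.
apply: nDD' => d D'd; have [|c Dc Idc] := sub (d * x).
  by exists d => //; rewrite subrr; apply: ideal0.
by apply: (idealBD hD _ Dc); apply: CD; rewrite /colon_elt /= mulrBl.
Qed.

Lemma len_ge1 I : ~ I 1 -> len_ge 1 I.
Proof.
move=> I1; apply: (@len_geS _ _ setT) (len_ge0 _) => //.
by split=> // h; apply: I1; apply: h.
Qed.

Lemma maximal_len_le M : is_maximal_ideal M -> len_le 1 M.
Proof.
move=> [hM M1 maxM] k h; move e : M h => M' h; case: h e => // n I J hJ IJ h e.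
have := maxM J hJ; case; first by rewrite e; case: IJ.
  by move=> JM; case: IJ => _; rewrite JM -e; case.
by move=> JT; rewrite JT in h; have := @len_le_setT 0 _ h; rewrite leqn0 => /eqP ->.
Qed.

Definition finite_len I := exists n, len_le n I.

(** The value 0 is a default when the length is infinite; [lenP] and the comparison lemmas therefore
    ask for [finite_len]. *)
Definition len I : nat :=
  if pselect (exists n, len_ge n I /\ len_le n I) is left h then sval (cid h) else 0%N.

Lemma lenP I : finite_len I -> len_ge (len I) I /\ len_le (len I) I.
Proof.
move=> [n hn]; rewrite /len; case: pselect => [h|nh]; first exact: (svalP (cid h)).
case: nh; elim: n hn => [|n IHn] hn.
  by exists 0%N; split=> //; exact: len_ge0.
have [h|nh] := pselect (len_ge n.+1 I); first by exists n.+1.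
apply: IHn => k hk; have := hn k hk; rewrite leq_eqVlt => /orP[/eqP e|//].
by case: nh; rewrite -e.
Qed.

Lemma finite_len_mono I J : I `<=` J -> finite_len I -> finite_len J.
Proof. by move=> IJ [n h]; exists n; exact: len_le_mono h. Qed.

Lemma len_leP n I : finite_len I -> len_le n I <-> (len I <= n)%N.
Proof.
move=> /lenP[h1 h2]; split=> [|h]; first by apply.
exact: len_le_leq h2.
Qed.

Lemma len_geP n I : finite_len I -> len_ge n I <-> (n <= len I)%N.
Proof.
move=> /lenP[h1 h2]; split=> [|h]; first by apply: h2.
exact: len_ge_leq h1.
Qed.

Lemma len_colon I x : is_ideal I -> finite_len I ->
  len I = (len (adjoin I x) + len (colon_elt I x))%N.
Proof.
move=> hI fI; have [h1 h2] := lenP fI.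
have [a1 a2] := lenP (finite_len_mono (@sub_adjoin _ I x) fI).
have [c1 c2] := lenP (finite_len_mono (@sub_colon_elt _ I x hI) fI).
apply/eqP; rewrite eqn_leq; apply/andP; split.
  by apply: (len_le_add hI a2 c2).
by apply: h2; apply: len_ge_add a1 c1.
Qed.

Lemma len_mono I J : I `<=` J -> finite_len I -> (len J <= len I)%N.
Proof.
move=> IJ fI; have [h1 h2] := lenP fI; have [a1 _] := lenP (finite_len_mono IJ fI).
by apply: h2; apply: len_ge_mono a1.
Qed.

Lemma len_eq I J : is_ideal J -> I `<=` J -> finite_len I -> (len I <= len J)%N -> I = J.
Proof.
move=> hJ IJ fI le; apply: contrapT => nIJ.
have [_ h2] := lenP fI; have [a1 _] := lenP (finite_len_mono IJ fI).
by have := h2 _ (proper_len_ge hJ IJ a1 nIJ); rewrite ltnNge le.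
Qed.

Lemma len_gt0 I : finite_len I -> ~ I 1 -> (0 < len I)%N.
Proof. by move=> fI I1; apply/len_geP => //; apply: len_ge1. Qed.

Lemma len_setT : len [set: R] = 0%N.
Proof.
apply/eqP; rewrite -leqn0; apply/len_leP; last exact: len_le_setT.
by exists 0%N; exact: len_le_setT.
Qed.

End Length.

(** * Independence in the sense of Lech, and colengths of ideals generated by powers *)

Section PowerSpans.
Variable R : comPzRingType.

Definition update n (f : 'I_n -> R) i g j := if j == i then g else f j.

Lemma update_eq n (f : 'I_n -> R) i g : update f i g i = g.
Proof. by rewrite /update eqxx. Qed.

Lemma update_neq n (f : 'I_n -> R) i g j : j != i -> update f i g j = f j.
Proof. by rewrite /update => /negbTE ->. Qed.

Lemma mem_update n (f : 'I_n -> R) i g : fspan (update f i g) g.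
Proof. by rewrite -[X in fspan _ X](update_eq f i g); exact: mem_span. Qed.

Lemma adjoin_span_update n (f : 'I_n -> R) i g h : f i = g * h ->
  adjoin (fspan f) g = fspan (update f i g).
Proof.
move=> fi; apply/seteqP; split.
  apply: adjoin_sub; first exact: span_ideal.
    apply: span_sub => [|j]; first exact: span_ideal.
    have [->|ji] := eqVneq j i; last first.
      by rewrite -(update_neq f g ji); exact: mem_span.
    rewrite fi; apply: (idealMr _ (span_ideal _)).
    exact: mem_update.
  exact: mem_update.
apply: span_sub => [|j]; first by apply: adjoin_ideal; exact: span_ideal.
rewrite /update; case: eqP => _; last by apply: sub_adjoin; exact: mem_span.
by apply: mem_adjoin; exact: span_ideal.
Qed.

Lemma span_update_sub_colon n (f : 'I_n -> R) i g h : f i = g * h ->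
  fspan (update f i h) `<=` colon_elt (fspan f) g.
Proof.
move=> fi; apply: span_sub => [|j]; first by apply: colon_elt_ideal; exact: span_ideal.
rewrite /update /colon_elt /=; case: eqP => _; first by rewrite mulrC -fi; exact: mem_span.
by apply: idealMr; [exact: span_ideal|exact: mem_span].
Qed.

(* Lech's notion of independence. *)
Definition independent n (f : 'I_n -> R) :=
  forall c : 'I_n -> R, \sum_i c i * f i = 0 -> forall i, fspan f (c i).

(** Multiplying the relation by h turns it into a relation among the f_j with coefficient c_i at i,
    so c_i = sum of b_k f_k. Substituting this back gives a second relation among the f_j, with
    coefficients c_j + b_j g for j different from i. *)
Lemma independent_factor n (f : 'I_n -> R) i g h : f i = g * h -> independent f ->
  forall c, \sum_j c j * update f i g j = 0 ->
  fspan f (c i) /\ forall j, fspan (update f i g) (c j).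
Proof.
move=> fi indf c c0.
have hS := span_ideal (update f i g).
have sfu : fspan f `<=` fspan (update f i g).
  by rewrite -(adjoin_span_update fi); exact: sub_adjoin.
have sci : fspan f (c i).
  have := indf (fun j => if j == i then c i else c j * h) _ i; rewrite eqxx; apply.
  transitivity (h * \sum_j c j * update f i g j); last by rewrite c0 mulr0.
  rewrite mulr_sumr; apply: eq_bigr => j _; rewrite /update.
  by have [->|_] := eqVneq j i; rewrite ?fi; ring.
split=> // j; have [->|ji] := eqVneq j i; first exact: sfu.
have [b cb] := sci.
have ind := indf (fun k => if k == i then b i * g else c k + b k * g).
have /ind /(_ j) : \sum_k (if k == i then b i * g else c k + b k * g) * f k = 0.
  rewrite -[RHS]c0 (bigD1 i) //= [RHS](bigD1 i) //= eqxx update_eq.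
  have -> : c i = b i * f i + \sum_(k < n | k != i) b k * f k by rewrite cb (bigD1 i).
  rewrite mulrDl -addrA.
  congr (_ + _); first by ring.
  rewrite mulr_suml -big_split /=; apply: eq_bigr => k ki.
  by rewrite (negbTE ki) update_neq //; ring.
rewrite (negbTE ji) => /sfu cj; have -> : c j = c j + b j * g - b j * g by ring.
apply: idealB => //; apply: idealMl => //.
exact: mem_update.
Qed.

Lemma independent_update n (f : 'I_n -> R) i g h : f i = g * h -> independent f ->
  independent (update f i g).
Proof. by move=> fi indf c c0 j; have [_] := independent_factor fi indf c0; apply. Qed.

(** If r g = sum of c_j f_j, then r - c_i h is the coefficient of g in a relation among the family
    with g at place i, so the first half of [independent_factor] puts it in the span of f. *)
Lemma independent_colon n (f : 'I_n -> R) i g h : f i = g * h -> independent f ->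
  colon_elt (fspan f) g = fspan (update f i h).
Proof.
move=> fi indf; apply/seteqP; split; last exact: span_update_sub_colon.
have fi' : f i = h * g by rewrite mulrC.
have sfu : fspan f `<=` fspan (update f i h).
  by rewrite -(adjoin_span_update fi'); exact: sub_adjoin.
move=> r [c rg]; have [] := independent_factor fi indf
    (c := fun j => if j == i then r - c i * h else - c j).
  have rg' : r * g = c i * (g * h) + \sum_(j < n | j != i) c j * f j.
    by rewrite rg (bigD1 i) //= fi.
  rewrite (bigD1 i) //= eqxx update_eq mulrBl rg'.
  rewrite [X in _ + X](eq_bigr (fun j => - (c j * f j))) ?sumrN; first by ring.
  by move=> j ji; rewrite (negbTE ji) update_neq // mulNr.
rewrite eqxx => /sfu hr _; apply: (idealBD (span_ideal _) hr).
apply: idealMl; first exact: span_ideal.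
exact: mem_update.
Qed.

Section Powers.
Variables (n : nat) (x : 'I_n -> R).
Hypothesis mx : is_maximal_ideal (fspan x).

Let powers (e : 'I_n -> nat) i := x i ^+ e i.
Let lower (e : 'I_n -> nat) i k (j : 'I_n) := if j == i then k else e j.

Let update_powers e i k : update (powers e) i (x i ^+ k) = powers (lower e i k).
Proof. by apply/funext => j; rewrite /update /powers /lower; case: eqP => // ->. Qed.

Let prod_lower e i : (0 < e i)%N ->
  (\prod_j e j = \prod_j lower e i 1 j + \prod_j lower e i (e i).-1 j)%N.
Proof.
move=> e0; rewrite (bigD1 i) //= [in RHS](bigD1 i) //= [X in (_ + X)%N](bigD1 i) //=.
rewrite {1 3}/lower eqxx.
have E k : (\prod_(j < n | j != i) lower e i k j = \prod_(j < n | j != i) e j)%N.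
  by apply: eq_bigr => j /negbTE; rewrite /lower => ->.
by rewrite !E -mulnDl add1n prednK.
Qed.

Let sum_lower e i k : (k < e i)%N -> (\sum_j lower e i k j < \sum_j e j)%N.
Proof.
move=> ke; rewrite (bigD1 i) //= [X in (_ < X)%N](bigD1 i) //= {1}/lower eqxx.
have -> : (\sum_(j < n | j != i) lower e i k j = \sum_(j < n | j != i) e j)%N.
  by apply: eq_bigr => j /negbTE; rewrite /lower => ->.
by rewrite ltn_add2r.
Qed.

Let exponent_cases (e : 'I_n -> nat) :
  [\/ (exists i, e i = 0%N), (forall i, e i = 1%N) | exists i, (1 < e i)%N].
Proof.
have [h|h0] := pselect (exists i, e i = 0%N); first exact: Or31.
have [h|h1] := pselect (exists i, (1 < e i)%N); [exact: Or33|apply: Or32 => i].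
apply/eqP; rewrite eqn_leq lt0n leqNgt; apply/andP; split.
  by apply/negP => h; apply: h1; exists i.
by apply/eqP => h; apply: h0; exists i.
Qed.

(** Splitting off one factor x_i lowers the exponent at i to 1 on the adjoining side and to e_i - 1
    on the colon side, and the product of the exponents adds up accordingly. When all exponents are
    1 the ideal is maximal. *)
Lemma span_powers_len_le e : len_le (\prod_i e i) (fspan (fun i => x i ^+ e i)).
Proof.
rewrite -/(powers e); have [m] := ubnP (\sum_i e i); elim: m e => // m IHm e; rewrite ltnS => em.
have [[i ei]|e1|[i ei]] := exponent_cases e.
- rewrite (ideal1 (span_ideal (powers e))); first exact: len_le_setT.
  by have := mem_span (powers e) i; rewrite {2}/powers ei expr0.
- have -> : powers e = x by apply/funext => i; rewrite /powers e1 expr1.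
  by rewrite big1 //; apply: maximal_len_le.
- have fi : powers e i = x i ^+ 1 * x i ^+ (e i).-1.
    by rewrite /powers -exprD add1n prednK // ltnW.
  rewrite (prod_lower (ltnW ei)).
  apply: (len_le_add (x := x i ^+ 1)) (span_ideal _) _ _.
    rewrite (adjoin_span_update fi) update_powers; apply: IHm.
    exact: leq_trans (sum_lower ei) em.
  apply: len_le_mono (span_update_sub_colon fi) _.
  rewrite update_powers; apply: IHm.
  by apply: leq_trans (sum_lower _) em; rewrite prednK // ltnW.
Qed.

(** The same recursion with equalities: independence identifies the colon exactly and is inherited
    by both new families. *)
Lemma span_powers_len_ge e : (forall i, (0 < e i)%N) ->
  independent (fun i => x i ^+ e i) ->
  len_ge (\prod_i e i) (fspan (fun i => x i ^+ e i)).
Proof.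
rewrite -/(powers e); have [m] := ubnP (\sum_i e i); elim: m e => // m IHm e; rewrite ltnS => em e0 inde.
have [[i ei]|e1|[i ei]] := exponent_cases e.
- by have := e0 i; rewrite ei.
- have -> : powers e = x by apply/funext => i; rewrite /powers e1 expr1.
  by rewrite big1 //; apply: len_ge1; case: mx.
- have fi : powers e i = x i ^+ 1 * x i ^+ (e i).-1.
    by rewrite /powers -exprD add1n prednK // ltnW.
  have fi' : powers e i = x i ^+ (e i).-1 * x i ^+ 1 by rewrite mulrC.
  have pr : (0 < (e i).-1)%N by rewrite -ltnS prednK // ltnW.
  rewrite (prod_lower (ltnW ei)).
  apply: (len_ge_add (x := x i ^+ 1)) (span_ideal _) _ _.
    rewrite (adjoin_span_update fi) update_powers; apply: IHm.
    + exact: leq_trans (sum_lower ei) em.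
    + by move=> j; rewrite /lower; case: eqP.
    + by have := independent_update fi inde; rewrite update_powers.
  rewrite (independent_colon fi inde) update_powers; apply: IHm.
  + by apply: leq_trans (sum_lower _) em; rewrite prednK // ltnW.
  + by move=> j; rewrite /lower; case: eqP.
  + by have := independent_update fi' inde; rewrite update_powers.
Qed.

End Powers.
End PowerSpans.

(** * The Artin-Rees lemma *)

Section WeakArtinRees.
Variable R : comPzRingType.
Hypothesis nR : noetherian R.
Implicit Types (I J K P Q M : set R) (x z r u : R).

(** Let c be the stage from which the colons (P + Rx : u^i) are constant, and k = N + c. If r x = g
    u^k modulo P, then g u^c is already r' x modulo P, and r - r' u^N lies in (P : x). *)
Lemma colon_adjoin_exp M P u x N : is_ideal P -> M u -> exists k,
  colon_elt (adjoin P (u ^+ k)) x `<=` ideal_add (colon_elt P x) (idpow M N).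
Proof.
move=> hP Mu; have hA := adjoin_ideal x hP.
have [|i z Fz|c Fc] := noetherian_acc nR (F := fun i => colon_elt (adjoin P x) (u ^+ i)).
- by move=> i; exact: colon_elt_ideal.
- by rewrite /colon_elt /= exprS mulrCA; apply: idealMl.
exists (N + c)%N => r [g Pg].
have [r' Pr'] : adjoin P x (g * u ^+ c).
  have : colon_elt (adjoin P x) (u ^+ (N + c)) g.
    exists r; rewrite -opprB; exact: idealN.
  by rewrite (Fc _ (leq_addl _ _)).
exists (r - r' * u ^+ N); last first.
  by rewrite subKr; apply: (idealMl _ (idpow_ideal _ _)); exact: idpow_expr.
rewrite /colon_elt /=.
have -> : (r - r' * u ^+ N) * x = (r * x - g * u ^+ (N + c)) + u ^+ N * (g * u ^+ c - r' * x).
  by rewrite exprD; ring.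
by apply: idealD => //; apply: idealMl.
Qed.

(* No control on [N'] in terms of [N], which is what makes it possible to adjoin
   powers of the generators of [M] one at a time. *)
Lemma weak_artin_rees M P x N : is_ideal M -> is_ideal P -> exists N',
  colon_elt (ideal_add P (idpow M N')) x `<=` ideal_add (colon_elt P x) (idpow M N).
Proof.
move=> hM hP; have [n [t eM]] := noetherian_span nR hM.
have hB Q : is_ideal Q -> is_ideal (ideal_add (colon_elt Q x) (idpow M N)).
  by move=> hQ; apply: ideal_add_ideal; [exact: colon_elt_ideal|exact: idpow_ideal].
(* The ideal is enlarged by a power of each listed element in turn; the errors all stay in the one
   ideal M^N, so they do not accumulate. *)
have H (s : seq R) : (forall u, u \in s -> M u) -> forall P, is_ideal P ->
    exists Q, [/\ is_ideal Q, P `<=` Q, forall u, u \in s -> exists k, Q (u ^+ k)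
      & colon_elt Q x `<=` ideal_add (colon_elt P x) (idpow M N)].
  elim: s => [|u s IHs] Ms {}P {}hP.
    by exists P; split=> //; apply: ideal_addl; exact: idpow_ideal.
  have [k Pk] := colon_adjoin_exp x N hP (Ms u (mem_head u s)).
  have hA := adjoin_ideal (u ^+ k) hP.
  have [v vs|Q [hQ PQ Qs Qx]] := IHs _ _ hA; first by apply: Ms; rewrite in_cons vs orbT.
  exists Q; split=> //; first exact: subset_trans (@sub_adjoin _ _ _) PQ.
    move=> v; rewrite in_cons => /orP[/eqP ->|/Qs //].
    by exists k; apply: PQ; exact: mem_adjoin.
  apply: subset_trans Qx _; apply: ideal_add_sub => //; first exact: hB.
  by apply: ideal_addr; exact: colon_elt_ideal.
have [u /mapP[i _ ->]|Q [hQ PQ Qt Qx]] := H [seq t i | i <- enum 'I_n] _ _ hP.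
  by rewrite eM; exact: mem_span.
have /choice[k Qk] : forall i, exists k, Q (t i ^+ k).
  by move=> i; apply: Qt; apply: map_f; rewrite mem_enum.
exists (\sum_i k i).+1; apply: subset_trans Qx; apply: colon_elt_mono.
by apply: ideal_add_sub => //; rewrite eM; exact: idpow_span_sub.
Qed.

(** The hypothesis puts 1 in (K + M^N' : r) for every N'; Artin-Rees at exponent 1 then puts 1 in (K
    : r) + M. *)
Lemma krull_intersection M K r : is_ideal M -> is_ideal K ->
  (forall N, ideal_add K (idpow M N) r) -> exists2 m, M m & K ((1 - m) * r).
Proof.
move=> hM hK Kr; have [N /(_ 1)[|a Ka]] := weak_artin_rees r 1 hM hK.
  by rewrite /colon_elt /= mul1r.
by rewrite idpow1 // => Ma; exists (1 - a) => //; rewrite subKr.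
Qed.

End WeakArtinRees.

(** * Hilbert's basis theorem *)

Section HilbertBasis.
Variable A : comNzRingType.
Hypothesis nA : noetherian A.

(** [L n] collects the coefficients of degree n of the elements of [E] of degree at most n. It grows
    with n and is constant from [n0] on, so finitely many polynomials of degree at most [n0] suffice
    to cancel any top coefficient. *)
Lemma noetherian_poly : noetherian {poly A}.
Proof.
move=> E hE.
pose L n := [set a | exists f, [/\ E f, (size f <= n.+1)%N & f`_n = a]].
have hL n : is_ideal (L n).
  split; first by exists 0; split; [exact: ideal0|rewrite size_poly0|rewrite coef0].
  - move=> a b [f [Ef sf fa]] [g [Eg sg gb]]; exists (f + g); split.
    + exact: idealD.
    + by rewrite (leq_trans (size_polyD _ _)) // geq_max sf.
    + by rewrite coefD fa gb.
  - move=> r a [f [Ef sf fa]]; exists (r%:P * f); split; first exact: idealMl.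
      by rewrite mul_polyC; apply: leq_trans (size_scale_leq _ _) sf.
    by rewrite coefCM fa.
have [//|n a [f [Ef sf fa]]|n0 Ln0] := noetherian_acc nA (F := L).
  exists ('X * f); split; first exact: idealMl; last by rewrite coefXM.
  by rewrite mulrC; apply: leq_trans (size_polyMleq _ _) _; rewrite size_polyX addn2.
have hG n : exists G : seq {poly A}, (forall f, f \in G -> E f /\ (size f <= n.+1)%N) /\
    L n = ideal_gen [set` [seq f`_n | f : {poly A} <- G]].
  have [s Ls] := nA (hL n); rewrite Ls.
  have {Ls} : forall a, a \in s -> L n a by move=> a sa; rewrite Ls; exact: sub_ideal_gen.
  move=> Ls; suff [G [GE Gs]] : exists G : seq {poly A},
      (forall f, f \in G -> E f /\ (size f <= n.+1)%N) /\ [seq f`_n | f : {poly A} <- G] = s.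
    by exists G; rewrite Gs.
  elim: s Ls => [|a s IHs] Ls; first by exists [::].
  have [b bs|G [GE Gs]] := IHs; first by apply: Ls; rewrite in_cons bs orbT.
  have [f [Ef sf fa]] := Ls a (mem_head a s).
  exists (f :: G); split; last by rewrite /= Gs fa.
  by move=> g; rewrite in_cons => /orP[/eqP ->|/GE].
have [G GP] := choice hG.
pose T := flatten [seq G n | n <- iota 0 n0.+1].
have hT := ideal_gen_ideal [set` T].
have TE : ideal_gen [set` T] `<=` E.
  apply: ideal_gen_sub => // f /= /flattenP[_ /mapP[n _ ->] fG].
  by have [/(_ f fG)[]] := GP n.
exists T; apply/seteqP; split=> // f; have [n] := ubnP (size f).
elim: n f => // n IHn f; rewrite ltnS leq_eqVlt => /orP[/eqP sf Ef|]; last exact: IHn.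
case: n => [|n] in IHn sf *.
  by move/eqP: sf; rewrite size_poly_eq0 => /eqP ->; exact: ideal0.
(* Beyond degree [n0] the top coefficient is already found in [L n0], and multiplication by X^(n -
   k) restores the degree. *)
pose k := minn n n0.
have Lk : L k f`_n.
  have Lnf : L n f`_n by exists f; rewrite sf.
  rewrite /k; have [//|/ltnW nn] := leqP n n0; by rewrite -(Ln0 n nn).
have [h [Th sh hk]] : exists h : {poly A}, [/\ ideal_gen [set` T] h, (size h <= k.+1)%N & h`_k = f`_n].
  have [GE GL] := GP k; rewrite GL in Lk.
  pose U := [set a | exists h : {poly A}, [/\ ideal_gen [set` T] h, (size h <= k.+1)%N & h`_k = a]].
  have hU : is_ideal U.
    split; first by exists 0; split; [exact: (ideal0 hT)|rewrite size_poly0|rewrite coef0].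
    - move=> a b [u [Eu su ua]] [g [Eg sg gb]]; exists (u + g); split.
      + exact: (idealD hT).
      + by rewrite (leq_trans (size_polyD _ _)) // geq_max su.
      + by rewrite coefD ua gb.
    - move=> r a [u [Eu su ua]]; exists (r%:P * u); split; first exact: (idealMl _ hT).
        by rewrite mul_polyC; apply: leq_trans (size_scale_leq _ _) su.
      by rewrite coefCM ua.
  suff GU : ideal_gen [set` [seq f`_k | f : {poly A} <- G k]] `<=` U by exact: GU Lk.
  apply: (ideal_gen_sub hU) => _ /= /mapP[g gG ->]; exists g.
  have [_ sg] := GE g gG; split=> //; apply: sub_ideal_gen => /=.
  apply/flattenP; exists (G k) => //; apply: map_f.
  by rewrite mem_iota add0n ltnS geq_minr.
have kn : (k <= n)%N by exact: geq_minl.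
have sX : (size ('X^(n - k) * h)%R <= n.+1)%N.
  apply: leq_trans (size_polyMleq _ _) _; rewrite size_polyXn addSn /=.
  by apply: leq_trans (leq_add (leqnn _) sh) _; rewrite addnS subnK.
have TX : ideal_gen [set` T] ('X^(n - k) * h) by exact: (idealMl _ hT).
apply: (idealBD hT _ TX); apply: IHn; last by apply: idealB => //; exact: TE.
rewrite ltnS; apply/leq_sizeP => j; rewrite leq_eqVlt => /orP[/eqP <-|nj].
  by rewrite coefB coefXnM ltnNge leq_subr /= subKn // hk subrr.
rewrite coefB [f`_j]nth_default ?sf // sub0r; apply/eqP; rewrite oppr_eq0; apply/eqP.
by apply: nth_default; apply: leq_trans sX nj.
Qed.

End HilbertBasis.

(** * The Artin-Rees lemma with a constant shift of exponents *)

Section ArtinRees.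

(** The Rees algebra, seen as polynomials with N-th coefficient in M^N, is closed under products. *)
Lemma idpow_conv (R : comNzRingType) (M : set R) (f g : {poly R}) :
  (forall N, idpow M N f`_N) -> (forall N, idpow M N g`_N) ->
  forall N, idpow M N (f * g)`_N.
Proof.
move=> Mf Mg N; rewrite coefM; apply: ideal_sum => [|i _]; first exact: idpow_ideal.
by rewrite -{1}(subnKC (leq_ord i)); apply: idpowD.
Qed.

(* A surjects onto the Rees algebra R + M X + M^2 X^2 + ... of M. *)
Lemma rees_cover (R : comNzRingType) (M : set R) (s : seq R) :
  is_ideal M -> noetherian R -> (forall u, u \in s -> M u) ->
  exists (A : comNzRingType) (psi : {rmorphism A -> {poly R}}),
  [/\ noetherian A, forall r, exists a, psi a = r%:P,
      forall u, u \in s -> exists a, psi a = u%:P * 'X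
    & forall a N, idpow M N (psi a)`_N].
Proof.
move=> hM nR; elim: s => [|u s IHs] Ms.
  exists R, (@polyC R); split=> //; first by move=> r; exists r.
  move=> a [|N] //; rewrite coefC /=; exact: (ideal0 (idpow_ideal M N.+1)).
have [v vs|A [psi [nA psiC psiX psiM]]] := IHs; first by apply: Ms; rewrite in_cons vs orbT.
have cfu : commr_rmorph psi (u%:P * 'X) by move=> a; exact: mulrC.
exists {poly A}, (horner_morph cfu); split; first exact: noetherian_poly.
- by move=> r; have [a <-] := psiC r; exists a%:P; rewrite /= horner_morphC.
- move=> v; rewrite in_cons => /orP[/eqP ->|/psiX[a <-]].
    by exists 'X; rewrite /= horner_morphX.
  by exists a%:P; rewrite /= horner_morphC.
have Mu : idpow M 1 u by rewrite idpow1 //; apply: Ms; exact: mem_head.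
have MuX N : idpow M N (u%:P * 'X)`_N.
  rewrite coefCM coefX; case: N => [|[|N]] //=.
    by rewrite mulr1.
  rewrite mulr0; exact: (ideal0 (idpow_ideal M N.+2)).
elim/poly_ind => [|p c IHp] N.
  by rewrite rmorph0 coef0; exact: (ideal0 (idpow_ideal M N)).
rewrite rmorphD rmorphM /= horner_morphX horner_morphC coefD.
by apply: idealD; [exact: idpow_ideal|exact: idpow_conv|exact: psiM].
Qed.

(** The usual inclusion of the intersection of M^(N + c) and B in M^N B, where [J] stands for any
    ideal containing the products that generate M^N B. *)
Lemma artin_rees_nz (R : comNzRingType) (M B : set R) :
  noetherian R -> is_ideal M -> is_ideal B ->
  exists c, forall N J v, is_ideal J ->
    (forall m b, idpow M N m -> B b -> J (m * b)) ->
    idpow M (N + c) v -> B v -> J v.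
Proof.
move=> nR hM hB; have [s sM] := nR M hM.
have [u us|A [psi [nA psiC psiX psiM]]] := @rees_cover R M s hM nR.
  by rewrite sM; exact: sub_ideal_gen.
have psi_ideal k : is_ideal [set r | exists a, psi a = r%:P * 'X^k].
  split; first by exists 0; rewrite rmorph0 mul0r.
  - by move=> x y [a ax] [b bx]; exists (a + b); rewrite rmorphD ax bx polyCD mulrDl.
  - move=> r x [a ax]; have [b bx] := psiC r; exists (b * a).
    by rewrite rmorphM ax bx polyCM mulrA.
have psi1 u : M u -> exists a, psi a = u%:P * 'X^1.
  rewrite sM; have /ideal_gen_sub := psi_ideal 1%N; apply=> v vs.
  by have [a av] := psiX v vs; exists a; rewrite expr1.
have psi_pow N r : idpow M N r -> exists a, psi a = r%:P * 'X^N.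
  elim: N r => [|N IHN] r Mr; first by have [a ar] := psiC r; exists a; rewrite expr0 mulr1.
  have /idpowS_sub := psi_ideal N.+1; apply; last exact: Mr.
  move=> x y /psi1[a ax] /IHN[b bx]; exists (a * b); rewrite rmorphM ax bx polyCM [in RHS]exprS expr1.
  by ring.
(* [E] is the preimage of the polynomials with coefficients in [B]. It is finitely generated, and
   [c] bounds the sizes of the images of its generators: in degree at least N + c they only meet
   factors of degree at least N, whose coefficients lie in M^N. *)
pose E := [set a | forall N, B (psi a)`_N].
have hE : is_ideal E.
  split=> [N|a b Ea Eb N|r a Ea N].
  - by rewrite rmorph0 coef0; exact: ideal0.
  - by rewrite rmorphD coefD; apply: idealD; [|apply: Ea|apply: Eb].
  - rewrite rmorphM coefM; apply: ideal_sum => // i _; apply: idealMl => //; exact: Ea.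
have [g Eg] := nA _ hE.
pose c := (\max_(a <- g) size (psi a))%N.
exists c => N J v hJ JMB Mv Bv.
have [a av] := psi_pow _ _ Mv.
have Ea : E a.
  move=> k; rewrite av coefCM coefXn; case: eqP => _; last by rewrite mulr0; exact: ideal0.
  by rewrite mulr1.
suff : E `<=` [set a | J (psi a)`_(N + c)].
  by move/(_ a Ea); rewrite /= av coefCM coefXn eqxx mulr1.
have Jm k (m b : R) : (N <= k)%N -> idpow M k m -> B b -> J (m * b).
  by move=> Nk Mm Bb; apply: JMB => //; exact: idpow_le Mm.
suff H : E `<=` [set a | forall k, (N + c <= k)%N -> J (psi a)`_k].
  by move=> b /H; apply.
have HE (b : A) : E b -> b \in g -> forall x k, (N + c <= k)%N -> J (psi (x * b))`_k.
  move=> Eb bg x k Nk; rewrite rmorphM coefM; apply: ideal_sum => // i _.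
  have [ki|ik] := leqP (size (psi b)) (k - i).
    by rewrite [X in _ * X]nth_default // mulr0; exact: ideal0.
  apply: (Jm i) => //.
  have : (size (psi b) <= c)%N by rewrite /c; apply: (leq_bigmax_seq (F := fun a => size (psi a))).
  by have := leq_ord i; lia.
rewrite {1}Eg gen_seq_span => _ [f ->] k Nk.
rewrite rmorph_sum coef_sum; apply: ideal_sum => // i _; apply: HE => //.
  by rewrite Eg; apply: sub_ideal_gen => /=; exact: mem_nth.
exact: mem_nth.
Qed.

(** If r x - b lies in M^(N + c) with b in P, it also lies in B = P + Rx, hence in P + M^N x, and
    the multiple m x so obtained corrects r to r - m. *)
Lemma artin_rees (R : comPzRingType) (M P : set R) x : noetherian R ->
  is_ideal M -> is_ideal P -> ~ P 1 -> exists c, forall N,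
  colon_elt (ideal_add P (idpow M (N + c))) x `<=` ideal_add (colon_elt P x) (idpow M N).
Proof.
move=> nR hM hP P1.
(* As P is proper, 1 is nonzero, so R can be repackaged as a [comNzRingType] and serve as a ring of
   coefficients. *)
have nz : (1 : R) != 0 by apply/eqP => e; apply: P1; rewrite e; exact: ideal0.
pose R' : comNzRingType := HB.pack (GRing.ComPzRing.sort R)
  (GRing.PzSemiRing_isNonZero.Build R nz).
have hA := adjoin_ideal x hP.
have [c cP] := @artin_rees_nz R' M (adjoin P x) nR hM hA.
exists c => N r [b Pb Mrb].
pose J := [set z | exists2 m, idpow M N m & P (z - m * x)].
have hJ : is_ideal J.
  have hN := idpow_ideal M N.
  split.
  - by exists 0; [|rewrite mul0r subrr]; exact: ideal0.
  - move=> y z [m Mm Py] [k Mk Pz]; exists (m + k); first exact: idealD.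
    by rewrite mulrDl opprD addrACA; apply: idealD.
  - move=> d y [m Mm Py]; exists (d * m); first exact: idealMl.
    by rewrite -mulrA -mulrBr; exact: idealMl.
have [m Mm Pm] : J (r * x - b).
  apply: (cP N J) => //; last by exists r; rewrite addrAC subrr sub0r; exact: idealN.
  move=> m d Mm [t Pt]; exists (m * t).
    by apply: (idealMr _ (idpow_ideal _ _)).
  have -> : (m : R) * d - m * t * x = m * (d - t * x) by ring.
  exact: idealMl.
exists (r - m); last by rewrite subKr.
rewrite /colon_elt /=; have -> : (r - m) * x = (r * x - b - m * x) + b by ring.
exact: idealD.
Qed.

End ArtinRees.

(** * Frobenius powers and colon ideals *)

Section FrobeniusPowers.
Variable R : comPzRingType.
Implicit Types (I J K P Q M : set R) (x z r u a b : R) (q : nat).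

(** Together with q > 0, this is all that the lemmas on Frobenius powers use about q = p^e. *)
Definition additive_power q := forall a b, (a + b) ^+ q = a ^+ q + b ^+ q.

Lemma additive_power_prime p e : prime p -> p%:R = 0 :> R -> additive_power (p ^ e).
Proof.
move=> pp p0; elim: e => [|e IHe] a b; first by rewrite expn0 !expr1.
rewrite expnSr !exprM IHe; move: (a ^+ _) (b ^+ _) => {}a {}b.
case: p pp p0 {IHe} => // p pp p0.
rewrite exprDn big_ord_recl big_ord_recr /= subn0 expr0 mulr1 subnn expr0 mul1r bin0 binn.
rewrite !mulr1n big1 ?add0r // => i _.
have /dvdnP[k ->] : (p.+1 %| 'C(p.+1, bump 0 i))%N.
  by apply: prime_dvd_bin => //; rewrite /bump /=; have := ltn_ord i; lia.
by rewrite mulrnA -mulr_natr p0 mulr0.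
Qed.

Lemma frobenius_power_ideal I q : is_ideal (frobenius_power I q).
Proof. exact: ideal_gen_ideal. Qed.

Lemma mem_frobenius_power I q a : I a -> frobenius_power I q (a ^+ q).
Proof. by move=> Ia; apply: sub_ideal_gen; exists a. Qed.

Lemma frobenius_power_sub I J q : is_ideal J -> (forall a, I a -> J (a ^+ q)) ->
  frobenius_power I q `<=` J.
Proof. by move=> hJ IJ; apply: ideal_gen_sub => // _ [a Ia <-]; exact: IJ. Qed.

Lemma frobenius_power_mono I J q : I `<=` J -> frobenius_power I q `<=` frobenius_power J q.
Proof.
move=> IJ; apply: frobenius_power_sub; first exact: frobenius_power_ideal.
by move=> a /IJ; exact: mem_frobenius_power.
Qed.

Lemma frobenius_colon_sub I x q : is_ideal I ->
  frobenius_power (colon_elt I x) q `<=` colon_elt (frobenius_power I q) (x ^+ q).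
Proof.
move=> hI; apply: frobenius_power_sub => [|a Ia].
  by apply: colon_elt_ideal; exact: frobenius_power_ideal.
by rewrite /colon_elt /= -exprMn; apply: mem_frobenius_power.
Qed.

Lemma additive_powerB q a b : additive_power q -> (a - b) ^+ q = a ^+ q - b ^+ q.
Proof. by move=> addq; apply: (addIr (b ^+ q)); rewrite -addq !subrK. Qed.

Lemma additive_power_ideal q J : additive_power q -> (0 < q)%N -> is_ideal J ->
  is_ideal [set a | J (a ^+ q)].
Proof.
move=> addq q0 hJ; split=> /=.
- by rewrite expr0n gtn_eqF //; exact: ideal0.
- by move=> a b Ja Jb; rewrite addq; exact: idealD.
- by move=> r a Ja; rewrite exprMn; exact: idealMl.
Qed.

Section Additive.
Variable q : nat.
Hypotheses (addq : additive_power q) (q0 : (0 < q)%N).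

Lemma frobenius_power_gen (S : set R) :
  frobenius_power (ideal_gen S) q = ideal_gen [set a ^+ q | a in S].
Proof.
have hG := ideal_gen_ideal [set a ^+ q | a in S].
apply/seteqP; split; last first.
  apply: ideal_gen_sub => [|_ [a Sa <-]]; first exact: frobenius_power_ideal.
  by apply: mem_frobenius_power; exact: sub_ideal_gen.
apply: frobenius_power_sub => // a.
have /ideal_gen_sub := additive_power_ideal addq q0 hG; apply=> b Sb.
by apply: sub_ideal_gen; exists b.
Qed.

Lemma frobenius_power_fspan n (f : 'I_n -> R) :
  frobenius_power (fspan f) q = fspan (fun i => f i ^+ q).
Proof.
rewrite !span_gen frobenius_power_gen; congr ideal_gen.
apply/seteqP; split=> [_ [_ [i _ <-] <-]|_ [i _ <-]]; first by exists i.
by exists (f i) => //; exists i.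
Qed.

Lemma frobenius_power_comp I k :
  frobenius_power (frobenius_power I k) q = frobenius_power I (k * q).
Proof.
rewrite [frobenius_power I k]/frobenius_power frobenius_power_gen.
congr ideal_gen; apply/seteqP; split=> [_ [_ [a Ia <-] <-]|_ [a Ia <-]].
  by exists a => //; rewrite exprM.
by exists (a ^+ k); [exists a|rewrite exprM].
Qed.

Lemma frobenius_power_adjoin I x : is_ideal I ->
  frobenius_power (adjoin I x) q = adjoin (frobenius_power I q) (x ^+ q).
Proof.
move=> hI; have hF := frobenius_power_ideal I q; apply/seteqP; split.
  apply: frobenius_power_sub => [|a [r Ia]]; first exact: adjoin_ideal.
  exists (r ^+ q); rewrite -exprMn -additive_powerB //; exact: mem_frobenius_power.
apply: adjoin_sub; first exact: frobenius_power_ideal.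
  by apply: frobenius_power_mono; exact: sub_adjoin.
by apply: mem_frobenius_power; exact: mem_adjoin.
Qed.

Lemma frobenius_power_add_sub I J : is_ideal J ->
  frobenius_power (ideal_add I J) q `<=` ideal_add (frobenius_power I q) J.
Proof.
move=> hJ; apply: frobenius_power_sub => [|z [a Ia Jz]].
  by apply: ideal_add_ideal => //; exact: frobenius_power_ideal.
exists (a ^+ q); first exact: mem_frobenius_power.
by rewrite -additive_powerB //; exact: idealX.
Qed.

End Additive.

(** Condition (C) for a single q, stated as the inclusion that is not automatic;
    [frobenius_colon_sub] is the other one. *)
Definition frobenius_colon q := forall I, is_ideal I -> forall x r,
  frobenius_power I q (r * x ^+ q) -> frobenius_power (colon_elt I x) q r.

Lemma frobenius_colon_elt q I x : frobenius_colon q -> is_ideal I ->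
  colon_elt (frobenius_power I q) (x ^+ q) = frobenius_power (colon_elt I x) q.
Proof.
move=> cR hI; apply/seteqP; split; last exact: frobenius_colon_sub.
by move=> r; exact: cR.
Qed.

(** If r is not in K = (I : x)^[q], then (K : r) lies in a maximal ideal M. The hypothesis for I +
    M^N' and weak Artin-Rees give r in K + M^N for all N, so Krull's theorem puts some 1 - m with m
    in M into (K : r), hence into M. *)
Lemma frobenius_colon_of_pow q : noetherian R -> additive_power q -> (0 < q)%N ->
  (forall M, is_maximal_ideal M -> forall (a : set R) N, is_ideal a -> idpow M N `<=` a ->
     forall x r, frobenius_power a q (r * x ^+ q) -> frobenius_power (colon_elt a x) q r) ->
  frobenius_colon q.
Proof.
move=> nR addq q0 H I hI x r Ir; apply: contrapT => nKr.
set K := frobenius_power _ q in nKr.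
have hK : is_ideal K := frobenius_power_ideal _ _.
have hC := colon_elt_ideal x hI.
have [|M mM KM] := exists_maximal nR (colon_elt_ideal r hK).
  by rewrite /colon_elt /= mul1r.
have [hM M1 _] := mM.
have [m Mm /KM M1m] : exists2 m, M m & K ((1 - m) * r); last first.
  by apply: M1; exact: (idealBD hM M1m Mm).
apply: (krull_intersection nR hM hK) => N.
have [N' IN] := weak_artin_rees nR x N hM hI.
have hP := idpow_ideal M N; have hP' := idpow_ideal M N'.
apply: (frobenius_power_add_sub addq q0 hP); apply: (frobenius_power_mono IN).
apply: (H M mM _ N'); first exact: ideal_add_ideal.
  exact: ideal_addr.
by apply: frobenius_power_mono Ir; exact: ideal_addl.
Qed.

(** Induction on generators of B. With B = G + Rb, write r = t b^q modulo G^[q]; then t b^q is in (A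
    + G)^[q], so (C) puts t in (A + G : b)^[q]. If c b = a + g with a in A and g in G, then a also
    lies in B; hence t b^q is, modulo G^[q], an element v of the right-hand side, and r - v is
    handled by induction. *)
Lemma frobenius_power_capI q (A B : set R) : noetherian R -> additive_power q -> (0 < q)%N ->
  frobenius_colon q -> is_ideal A -> is_ideal B ->
  frobenius_power A q `&` frobenius_power B q `<=` frobenius_power (A `&` B) q.
Proof.
move=> nR addq q0 cR hA hB r [Ar Br]; have [s eB] := nR B hB.
have hC : is_ideal (frobenius_power (A `&` B) q) := frobenius_power_ideal _ _.
(* Only the inclusion of the list in [B] is kept, so that the list can shrink while the target stays
   fixed. *)
have {eB} sB : exists2 S : seq R, (forall b, b \in S -> B b) & frobenius_power (ideal_gen [set` S]) q r.
  by exists s; rewrite -?eB // => b bs; rewrite eB; exact: sub_ideal_gen.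
have [{}s {}sB {}Br] := sB.
elim: s sB r Ar Br => [|b s IHs] sB r Ar Br.
  move: Br; rewrite frobenius_power_gen //.
  by apply: (ideal_gen_sub hC) => _ [x xs <-]; move: xs; rewrite /= in_nil.
have Bb : B b by apply: sB; exact: mem_head.
have {}sB c : c \in s -> B c by move=> cs; apply: sB; rewrite in_cons cs orbT.
set G := ideal_gen [set` s]; have hG : is_ideal G := ideal_gen_ideal _.
have GB : G `<=` B by apply: ideal_gen_sub.
have hFG : is_ideal (frobenius_power G q) := frobenius_power_ideal _ _.
have [t Gt] : adjoin (frobenius_power G q) (b ^+ q) r.
  rewrite -frobenius_power_adjoin //; apply: frobenius_power_mono Br.
  apply: ideal_gen_sub; first exact: adjoin_ideal.
  move=> c /=; rewrite in_cons => /orP[/eqP ->|cs]; first exact: mem_adjoin.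
  by apply: sub_adjoin; exact: sub_ideal_gen.
have hFA : is_ideal (frobenius_power A q) := frobenius_power_ideal _ _.
have hAG := ideal_add_ideal hA hG.
have tC : frobenius_power (colon_elt (ideal_add A G) b) q t.
  apply: cR => //; have hF := frobenius_power_ideal (ideal_add A G) q.
  have -> : t * b ^+ q = r - (r - t * b ^+ q) by ring.
  apply: (idealB hF).
    by apply: frobenius_power_mono Ar; exact: ideal_addl.
  by apply: frobenius_power_mono Gt; exact: ideal_addr.
have [v Cv Gv] : ideal_add (frobenius_power (A `&` B) q) (frobenius_power G q) (t * b ^+ q).
  have hS := ideal_add_ideal hC hFG.
  have := colon_elt_ideal (b ^+ q) hS.
  move/frobenius_power_sub => /(_ (colon_elt (ideal_add A G) b) q); apply; last exact: tC.
  move=> c [a Aa Gc]; rewrite /colon_elt /=; exists (a ^+ q).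
    apply: mem_frobenius_power; split=> //.
    by apply: (idealBD hB (b := a - c * b)); [rewrite subKr; exact: idealMl|
      rewrite -opprB; apply: idealN => //; exact: GB].
  by rewrite -exprMn -additive_powerB //; exact: mem_frobenius_power.
have -> : r = v + (r - v) by ring.
apply: (idealD hC Cv); apply: IHs => //.
  by apply: (idealB hFA) => //; apply: frobenius_power_mono Cv => x [].
have -> : r - v = (r - t * b ^+ q) + (t * b ^+ q - v) by ring.
exact: (idealD hFG).
Qed.

(** (I : J) is the finite intersection of the (I : b) over generators b of J, so compatibility with
    intersections reduces the claim to (C). *)
Lemma frobenius_colon_ideal q I J : noetherian R -> additive_power q -> (0 < q)%N ->
  frobenius_colon q -> is_ideal I -> is_ideal J ->
  colon (frobenius_power I q) (frobenius_power J q) = frobenius_power (colon I J) q.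
Proof.
move=> nR addq q0 cR hI hJ; have hF := frobenius_power_ideal I q.
apply/seteqP; split=> r; last first.
  apply: frobenius_power_sub; first exact: colon_ideal.
  move=> a IJa y; have := colon_elt_ideal (a ^+ q) hF.
  move/frobenius_power_sub => /(_ J q) H Jy; rewrite mulrC; apply: H Jy => b Jb.
  by rewrite /colon_elt /= -exprMn mulrC; apply: mem_frobenius_power; exact: IJa.
move=> rJ; have [s eJ] := nR J hJ.
have -> : colon I J = [set a | forall b, b \in s -> I (a * b)].
  apply/seteqP; split=> a /= Ia; first by move=> b bs; apply: Ia; rewrite eJ; exact: sub_ideal_gen.
  move=> b; rewrite mulrC eJ; have /ideal_gen_sub := colon_elt_ideal a hI; apply=> c cs.
  by rewrite /colon_elt /= mulrC; exact: Ia.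
have {rJ eJ} : forall b, b \in s -> frobenius_power I q (r * b ^+ q).
  move=> b bs; apply: rJ; apply: mem_frobenius_power; rewrite eJ; exact: sub_ideal_gen.
elim: s => [|b s IHs] rs.
  rewrite (ideal1 (frobenius_power_ideal _ _)) //.
  by rewrite -(expr1n _ q); apply: mem_frobenius_power.
have hs : is_ideal [set a | forall b, b \in s -> I (a * b)].
  split=> [c _|a c Ia Ic d ds|t a Ia d ds].
  - by rewrite mul0r; exact: ideal0.
  - by rewrite mulrDl; apply: idealD; [|exact: Ia|exact: Ic].
  - by rewrite -mulrA; apply: idealMl => //; exact: Ia.
have -> : [set a | forall c, c \in b :: s -> I (a * c)] =
    colon_elt I b `&` [set a | forall c, c \in s -> I (a * c)].
  apply/seteqP; split=> [a /= Ia|a /= [Ib Ia] c].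
    split; first by apply: Ia; exact: mem_head.
    by move=> c cs; apply: Ia; rewrite in_cons cs orbT.
  by rewrite in_cons => /orP[/eqP -> //|]; exact: Ia.
apply: frobenius_power_capI => //; first exact: colon_elt_ideal.
split; first by apply: cR => //; apply: rs; exact: mem_head.
by apply: IHs => c cs; apply: rs; rewrite in_cons cs orbT.
Qed.

End FrobeniusPowers.

(** * Localization *)

Section AbstractLocalization.
Variables (R S : comPzRingType) (P : set R) (iota : {rmorphism R -> S}).

(** Every element is a fraction, the kernel is the expected torsion, and denominators become units.
    Working from these properties confines the quotient construction to [loc_map_localization]. *)
Definition is_localization :=
  [/\ forall z, exists a s, ~ P s /\ iota s * z = iota a,
      forall a, iota a = 0 -> exists2 u, ~ P u & u * a = 0
    & forall s, ~ P s -> exists t, iota s * t = 1].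

Hypotheses (pP : is_prime_ideal P) (locP : is_localization).

Let out1 : ~ P 1. Proof. by case: pP. Qed.

Let outM a b : ~ P a -> ~ P b -> ~ P (a * b).
Proof. by case: pP => _ _ H Pa Pb /H[]. Qed.

Lemma preim_ideal (I : set S) : is_ideal I -> is_ideal (iota @^-1` I).
Proof.
move=> hI; split=> /=; first by rewrite rmorph0; exact: ideal0.
- by move=> a b Ia Ib; rewrite rmorphD; exact: idealD.
- by move=> r a Ia; rewrite rmorphM; exact: idealMl.
Qed.

Lemma localization_cancel (I : set S) s z : is_ideal I -> ~ P s -> I (iota s * z) -> I z.
Proof.
case: locP => _ _ unit hI /unit[t st] Isz.
have -> : z = t * (iota s * z) by rewrite mulrA [t * _]mulrC st mul1r.
exact: idealMl.
Qed.

Definition extension (I : set R) : set S :=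
  [set z | exists s a, [/\ ~ P s, I a & iota s * z = iota a]].

Lemma extension_ideal I : is_ideal I -> is_ideal (extension I).
Proof.
move=> hI; split.
- by exists 1, 0; split=> //; [exact: ideal0|rewrite mulr0 rmorph0].
- move=> y z [s [a [Ps Ia sa]]] [t [b [Pt Ib tb]]]; exists (s * t), (t * a + s * b).
  split; [exact: outM|by apply: idealD => //; exact: idealMl|].
  by rewrite rmorphD !rmorphM -sa -tb; ring.
- move=> r z [s [a [Ps Ia sa]]]; have [/(_ r)[b [t [Pt tb]]] _ _] := locP.
  exists (t * s), (b * a); split; [exact: outM|exact: idealMl|].
  by rewrite !rmorphM -sa -tb; ring.
Qed.

Lemma mem_extension (I : set R) a : I a -> extension I (iota a).
Proof. by move=> Ia; exists 1, a; split=> //; rewrite rmorph1 mul1r. Qed.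

Lemma extension_contract I a : is_ideal I -> extension I (iota a) ->
  exists2 s, ~ P s & I (s * a).
Proof.
move=> hI [s [b [Ps Ib sb]]]; have [_ inj _] := locP.
have [|u Pu e] := inj (s * a - b).
  by rewrite rmorphB rmorphM sb subrr.
exists (u * s); first exact: outM.
have -> : u * s * a = u * (s * a - b) + u * b by ring.
by rewrite e add0r; apply: idealMl.
Qed.

Lemma extension_preim (I : set S) : is_ideal I -> extension (iota @^-1` I) = I.
Proof.
move=> hI; apply/seteqP; split=> z.
  by move=> [s [a [Ps Ia sa]]]; apply: (localization_cancel hI Ps); rewrite sa.
move=> Iz; have [/(_ z)[a [s [Ps sa]]] _ _] := locP.
by exists s, a; split=> //=; rewrite -sa; exact: idealMl.
Qed.

Lemma extension_sub (I : set R) (J : set S) : is_ideal J ->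
  (forall a, I a -> J (iota a)) -> extension I `<=` J.
Proof.
by move=> hJ IJ z [s [a [Ps /IJ Ja sa]]]; apply: (localization_cancel hJ Ps); rewrite sa.
Qed.

Lemma localization_noetherian : noetherian R -> noetherian S.
Proof.
move=> nR I hI; have [s sI] := nR _ (preim_ideal hI).
exists [seq iota a | a <- s]; rewrite -{1}(extension_preim hI) sI.
have hG := ideal_gen_ideal [set` [seq iota a | a <- s]].
apply/seteqP; split.
  apply: extension_sub => // a; have /ideal_gen_sub := preim_ideal hG; apply=> b bs.
  by apply: sub_ideal_gen; apply: map_f.
apply: ideal_gen_sub => [|_ /= /mapP[a sa ->]].
  by apply: extension_ideal; exact: ideal_gen_ideal.
by apply: mem_extension; exact: sub_ideal_gen.
Qed.

Lemma localization_local : is_local_with (extension P).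
Proof.
have hE : is_ideal (extension P) by apply: extension_ideal; case: pP.
have E1 : ~ extension P 1.
  rewrite -(rmorph1 iota) => /extension_contract[|s Ps]; first by case: pP.
  by rewrite mulr1.
have unitE (I : set S) z : is_ideal I -> I z -> ~ extension P z -> I = setT.
  move=> hI Iz nEz; apply: ideal1 => //; have [/(_ z)[a [s [Ps sa]]] _ _] := locP.
  have Pa : ~ P a by move=> Pa; apply: nEz; exists s, a.
  by apply: (localization_cancel hI Pa); rewrite mulr1 -sa; exact: idealMl.
have maxE : is_maximal_ideal (extension P).
  split=> // I hI EI; have [IE|] := pselect (I `<=` extension P).
    by left; apply/seteqP.
  by move=> /existsNP[z /not_implyP[Iz nEz]]; right; exact: unitE Iz nEz.
split=> // M [hM M1 maxM]; have [ME|] := pselect (M `<=` extension P).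
  have [-> //|ET] := maxM _ hE ME.
  by case: E1; rewrite ET.
by move=> /existsNP[z /not_implyP[Mz nEz]]; case: M1; rewrite (unitE M z).
Qed.

Lemma frobenius_extension I q z : is_ideal I ->
  frobenius_power (extension I) q z -> extension (frobenius_power I q) z.
Proof.
move=> hI; have hF := frobenius_power_ideal I q.
have := extension_ideal hF => /frobenius_power_sub; apply=> y [s [a [Ps Ia sa]]].
exists (s ^+ q), (a ^+ q); split.
- elim: q {hF} => [|q IHq]; first by rewrite expr0.
  by rewrite exprS; exact: outM.
- exact: mem_frobenius_power.
- by rewrite !rmorphXn -sa exprMn.
Qed.

Lemma extension_frobenius (I : set S) (J : set R) q a : is_ideal I ->
  (forall b, J b -> I (iota b)) -> frobenius_power J q a -> frobenius_power I q (iota a).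
Proof.
move=> hI JI; have hF := frobenius_power_ideal I q.
move/frobenius_power_sub: (preim_ideal hF); apply=> b /JI Ib /=.
by rewrite rmorphXn; exact: mem_frobenius_power.
Qed.

(** Clearing the denominators s of x and t of r brings the membership down to R, up to a factor u
    outside P. After (C) in R, extending back makes s, t and u units. *)
Lemma frobenius_colon_localization q : frobenius_colon R q -> frobenius_colon S q.
Proof.
move=> cR I hI x r; have hJ := preim_ideal hI; have hC := colon_elt_ideal x hI.
have [loc _ _] := locP.
have [x' [s [Ps sx]]] := loc x; have [r' [t [Pt tr]]] := loc r.
have hF := frobenius_power_ideal I q; move=> Ir.
have {Ir} : frobenius_power I q (iota (r' * x' ^+ q)).
  rewrite rmorphM rmorphXn -sx -tr exprMn.
  have -> : iota t * r * (iota s ^+ q * x ^+ q) = iota t * iota s ^+ q * (r * x ^+ q) by ring.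
  exact: (idealMl _ hF).
rewrite -{1}(extension_preim hI) => /(frobenius_extension hJ).
move=> /extension_contract[|u Pu]; first exact: frobenius_power_ideal.
rewrite mulrA => /(cR _ hJ) => /(@extension_frobenius (colon_elt I x)) H.
have hK := frobenius_power_ideal (colon_elt I x) q.
apply: (localization_cancel hK Pt); rewrite tr.
apply: (localization_cancel hK Pu); rewrite -rmorphM; apply: H => // b.
rewrite /colon_elt /= rmorphM -sx => H; apply: (localization_cancel hI Ps).
by rewrite mulrCA.
Qed.

(** Contracting an extended ideal costs a multiplier u outside P. This suffices for a local check:
    it says that ((I : x)^[q] : r) is not contained in P. *)
Lemma frobenius_colon_contract q I x r : frobenius_colon S q -> is_ideal I ->
  frobenius_power I q (r * x ^+ q) ->
  exists2 u, ~ P u & frobenius_power (colon_elt I x) q (u * r).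
Proof.
move=> cS hI Ir; have hE := extension_ideal hI; have hC := colon_elt_ideal x hI.
apply: extension_contract; first exact: frobenius_power_ideal.
apply: frobenius_extension => //.
have : frobenius_power (colon_elt (extension I) (iota x)) q (iota r).
  apply: cS => //; rewrite -rmorphXn -rmorphM.
  by apply: (extension_frobenius hE _ Ir) => b; exact: mem_extension.
apply: frobenius_power_mono => y; rewrite /colon_elt /=.
have [/(_ y)[a [s [Ps sa]]] _ _] := locP => Iyx.
have [|u Pu Iu] := @extension_contract I (a * x) hI.
  by rewrite rmorphM -sa -mulrA; exact: idealMl.
exists (u * s), (u * a); split; first exact: outM.
  by rewrite /colon_elt /= -mulrA.
by rewrite !rmorphM -sa mulrA.
Qed.

End AbstractLocalization.

Section LocalizationMap.
Variables (R : comPzRingType) (P : prime_ideal R).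
Local Open Scope quotient_scope.

Definition loc_map (a : R) : localization P :=
  Localization.mk a (@Localization.out1 R P).

Lemma loc_map_zmod_morphism : zmod_morphism loc_map.
Proof.
move=> a b; rewrite /loc_map /Localization.mk.
rewrite -[RHS]/(Localization.add _ (Localization.opp _)).
rewrite Localization.pi_opp Localization.pi_add; apply: Localization.pi_eq => /=; ring.
Qed.

Lemma loc_map_monoid_morphism : monoid_morphism loc_map.
Proof.
split=> // a b; rewrite /loc_map /Localization.mk.
rewrite -[RHS]/(Localization.mul _ _) Localization.pi_mul.
by apply: Localization.pi_eq => /=; ring.
Qed.

HB.instance Definition _ :=
  GRing.isZmodMorphism.Build R (localization P) loc_map loc_map_zmod_morphism.
HB.instance Definition _ :=
  GRing.isMonoidMorphism.Build R (localization P) loc_map loc_map_monoid_morphism.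

Lemma loc_map_localization : is_localization P loc_map.
Proof.
have mulE x y : (\pi_(Localization.type P) x : localization P) * \pi_(Localization.type P) y =
    \pi_(Localization.type P) (Localization.fmul x y) by exact: Localization.pi_mul.
split.
- elim/quotW=> x; exists (Localization.num x), (Localization.den x).
  split; first exact: Localization.den_out.
  by rewrite /= /loc_map /Localization.mk mulE; apply: Localization.pi_eq => /=; ring.
- move=> a /eqP/Localization.equivfP[u Pu /= e]; exists u => //.
  by move: e; rewrite mulr1 mul0r subr0.
- move=> s Ps; exists (Localization.mk 1 Ps).
  by rewrite /= /loc_map /Localization.mk mulE; apply: Localization.pi_eq => /=; ring.
Qed.

End LocalizationMap.

(** * Lengths and dimension of a Noetherian local ring *)

Lemma leq_expn m n k : (m <= n)%N -> (m ^ k <= n ^ k)%N.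
Proof. by case: k => // k mn; rewrite leq_exp2r. Qed.

(** A discrete mean value inequality: it lets a sum of n-th powers dominate a power with exponent n
    + 1. *)
Lemma expn_succ_le k n : (k.+1 ^ n.+1 <= k ^ n.+1 + n.+1 * k.+1 ^ n)%N.
Proof.
elim: n => [|n IHn]; first by rewrite !expn1 expn0; lia.
rewrite expnS (leq_trans (leq_mul (leqnn k.+1) IHn)) //.
have le : (k ^ n.+1 <= k.+1 ^ n.+1)%N by exact: leq_expn.
rewrite mulnDr mulnCA -expnS [in X in (_ <= X + _)%N]expnS; move: le.
by move: (k ^ n.+1)%N (k.+1 ^ n.+1)%N => u v; nia.
Qed.

(** For t > 0 this is Bernoulli's inequality (1 + 1/t)^j >= 1 + j/t, cleared of denominators and
    used at j = A t. *)
Lemma exp_overtakes t A : exists j, (A * t ^ j < t.+1 ^ j)%N.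
Proof.
case: t => [|t]; first by exists 1%N; rewrite muln0.
have H j : ((t.+1 + j) * t.+1 ^ j <= t.+1 * t.+2 ^ j)%N.
  elim: j => [|j IHj]; first by rewrite addn0.
  rewrite !expnS; apply: leq_trans (_ : t.+2 * ((t.+1 + j) * t.+1 ^ j) <= _)%N.
    by move: (t.+1 ^ j)%N => u; nia.
  by rewrite [X in (_ <= X)%N]mulnCA leq_mul2l IHj orbT.
exists (A * t.+1)%N; have := H (A * t.+1)%N.
rewrite -mulSn [(A.+1 * _)%N]mulnC -mulnA leq_pmul2l //; apply: leq_trans.
by rewrite ltn_mul2r expn_gt0 ltnSn.
Qed.

Section Growth.
Variable R : comPzRingType.
Hypothesis nR : noetherian R.
Variable M : set R.
Hypothesis locM : is_local_with M.
Implicit Types (I J K P Q : set R) (x z r u a b : R).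

Let mM : is_maximal_ideal M. Proof. by case: locM. Qed.
Let hM : is_ideal M. Proof. by case: mM. Qed.
Let M1 : ~ M 1. Proof. by case: mM. Qed.

Lemma proper_sub_maximal I : is_ideal I -> ~ I 1 -> I `<=` M.
Proof.
move=> hI I1; have [M' mM' IM] := exists_maximal nR hI I1.
by case: locM => _ /(_ _ mM') <-.
Qed.

Lemma prime_sub_maximal P : is_prime_ideal P -> P `<=` M.
Proof. by move=> [hP P1 _]; exact: proper_sub_maximal. Qed.

Lemma prime_colon P x : is_prime_ideal P -> ~ P x -> colon_elt P x = P.
Proof.
move=> [hP _ Pm] nPx; apply/seteqP; split; last exact: sub_colon_elt.
by move=> r /Pm[].
Qed.

(* Summing length(R/(P0 + x + M^j)) over j, with x in P1 but not in P0,
   raises the order of growth by one; the exponent is kept linear in k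
   thanks to the Artin-Rees lemma. *)
Lemma chain_growth n (P : nat -> set R) :
  (forall i, (i <= n)%N -> is_prime_ideal (P i)) ->
  (forall i, (i < n)%N -> P i `<` P i.+1) ->
  exists c C, (0 < c)%N /\ forall k, (0 < k)%N ->
    exists2 l, (k ^ n <= C * l)%N & len_ge l (ideal_add (P 0%N) (idpow M (c * k))).
Proof.
elim: n P => [|n IHn] P pP PS.
  exists 1%N, 1%N; split=> // k k0; exists 1%N => //.
  apply: len_ge1; rewrite mul1n => h; apply: M1; move: h.
  apply: ideal_add_sub => //; first exact: prime_sub_maximal (pP _ _).
  exact: idpow_sub.
have [|i ni|c1 [C1 [c10 g1]]] := IHn (fun i => P i.+1).
- by move=> i ni; exact: pP.
- exact: PS.
have [P01 /existsNP[x /not_implyP[P1x nP0x]]] := PS 0%N isT.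
have pP0 := pP 0%N isT; have [hP0 P01' _] := pP0.
have [c2 AR] := artin_rees x nR hM hP0 P01'.
(* The factor [c1] serves the growth above P 1, and c > c2 lets one step of k absorb the Artin-Rees
   shift: c (k + 1) - c2 >= c k. The factor n + 1 comes from [expn_succ_le]. *)
pose c := (c1 * c2.+1)%N; exists c, (n.+1 * C1)%N; split; first by rewrite muln_gt0 c10.
suff H k : exists2 l, (k ^ n.+1 <= n.+1 * C1 * l)%N
    & len_ge l (ideal_add (P 0%N) (idpow M (c * k))) by move=> k _.
elim: k => [|k [l kl gl]]; first by exists 0%N; [rewrite exp0n|exact: len_ge0].
have hN := idpow_ideal M.
have [l' kl' gl'] := g1 (c2.+1 * k.+1)%N isT.
exists (l' + l)%N.
  apply: leq_trans (expn_succ_le _ _) _; rewrite mulnDr addnC leq_add // -mulnA leq_mul2l /=.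
  by apply: leq_trans kl'; rewrite leq_expn // leq_pmull.
apply: (len_ge_add (x := x)); first exact: ideal_add_ideal.
  apply: len_ge_mono gl'; rewrite adjoin_add // mulnA.
  by apply: ideal_add_mono => //; apply: adjoin_sub => //; have [] := pP 1%N isT.
apply: len_ge_mono gl; rewrite -{2}(prime_colon pP0 nP0x).
have -> : (c * k.+1 = (c * k.+1 - c2) + c2)%N by rewrite subnK // /c; nia.
apply: subset_trans (AR _) _; apply: ideal_add_mono => //; apply: idpow_le.
by rewrite /c; nia.
Qed.

(** M^N contains the ideal generated by the x_i^N, whose colength is at most N^n. *)
Lemma idpow_len_le n (x : 'I_n -> R) N : M = fspan x -> len_le (N ^ n) (idpow M N).
Proof.
move=> eM; have := mM; rewrite eM => mx.
have := span_powers_len_le mx (e := fun=> N); rewrite prod_nat_const card_ord.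
apply: len_le_mono; apply: span_sub => [|i]; first exact: idpow_ideal.
by apply: idpow_expr; exact: mem_span.
Qed.

Lemma prime_chain_le n d (x : 'I_d -> R) : M = fspan x -> prime_chain R n -> (n <= d)%N.
Proof.
move=> eM [P [pP PS]]; have [c [C [c0 g]]] := chain_growth pP PS.
rewrite leqNgt; apply/negP => dn.
(* Growth of order at least d + 1 would give k^(d + 1) <= C (c k)^d, which this k violates. *)
pose k := (C * c ^ d).+1; have [l kl gl] := g k isT.
have lk : (l <= (c * k) ^ d)%N.
  apply: (idpow_len_le eM); apply: len_ge_mono gl.
  by apply: ideal_addr; case: (pP 0%N isT).
have : (k ^ d.+1 <= C * (c * k) ^ d)%N.
  apply: leq_trans (leq_trans kl _); first by rewrite leq_pexp2l.
  by rewrite leq_mul2l lk orbT.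
by rewrite expnS expnMn mulnA leq_pmul2r ?expn_gt0 // ltnn.
Qed.

(** A strict chain of primes above I, encoded recursively: x witnesses strictness, and the next
    prime has to contain P + Rx. *)
Fixpoint prime_tower n I : Prop :=
  if n is n'.+1 then exists P x, [/\ is_prime_ideal P, I `<=` P, ~ P x & prime_tower n' (adjoin P x)]
  else exists2 P, is_prime_ideal P & I `<=` P.

Lemma prime_tower_chain n I : prime_tower n I -> exists P : nat -> set R,
  [/\ forall i, (i <= n)%N -> is_prime_ideal (P i),
      forall i, (i < n)%N -> P i `<` P i.+1 & I `<=` P 0%N].
Proof.
elim: n I => [|n IHn] I; first by move=> [P pP IP]; exists (fun=> P).
move=> [P [x [pP IP nPx /IHn[Q [pQ QS PQ]]]]].
have hP : is_ideal P by case: pP.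
exists (fun i => if i is i'.+1 then Q i' else P); split=> //.
- by case=> // i; exact: pQ.
- case=> [_|i]; last exact: QS.
  split; first exact: subset_trans (@sub_adjoin _ _ _) PQ.
  by move=> QP; apply: nPx; apply: QP; apply: PQ; exact: mem_adjoin.
Qed.

(** Order of growth at most n. The shift to N + 1 keeps the power positive at N = 0. *)
Definition slow_growth n I :=
  exists C, forall N, len_le (C * N.+1 ^ n) (ideal_add I (idpow M N)).

(** Noetherian induction: if ab is in I but a and b are not, both I + Ra and (I : a) are strictly
    larger than I, and their growth bounds add up to one for I. *)
Lemma slow_growth_prime n I : is_ideal I ->
  (forall P, is_prime_ideal P -> I `<=` P -> slow_growth n P) -> slow_growth n I.
Proof.
elim/(noetherian_ind nR): I / => I hI IH slowP.
have [I1|nI1] := pselect (I 1).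
  exists 0%N => N; rewrite (ideal1 hI I1).
  have -> : ideal_add setT (idpow M N) = setT.
    by apply: ideal1; [exact: ideal_add_ideal (setT_ideal R) (idpow_ideal M N)|
      exact: ideal_addl (idpow_ideal M N) _ _].
  exact: len_le_setT.
have [pI|] := pselect (forall a b, I (a * b) -> I a \/ I b).
  by apply: slowP => //; split.
move=> /existsNP[a /existsNP[b /not_implyP[Iab /not_orP[nIa nIb]]]].
have hN := idpow_ideal M.
have IC : I `<` colon_elt I a.
  by split; [exact: sub_colon_elt|move=> /(_ b) h; apply: nIb; apply: h; rewrite /colon_elt /= mulrC].
have [P pP aP|C1 h1] := IH _ (adjoin_ideal a hI) (proper_adjoin hI nIa).
  by apply: slowP => //; apply: subset_trans aP; exact: sub_adjoin.
have [P pP aP|C2 h2] := IH _ (colon_elt_ideal a hI) IC.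
  by apply: slowP => //; apply: subset_trans aP; exact: sub_colon_elt.
exists (C1 + C2)%N => N; rewrite mulnDl; apply: (len_le_add (x := a)).
- exact: ideal_add_ideal.
- by rewrite adjoin_add.
apply: len_le_mono (h2 N); apply: ideal_add_sub.
- by apply: colon_elt_ideal; exact: ideal_add_ideal.
- by apply: colon_elt_mono; exact: ideal_addl.
- apply: subset_trans (@sub_colon_elt _ _ _ _); first exact: ideal_addr.
  exact: ideal_add_ideal.
Qed.

(** Since x is in M, (P + M^(N+1) : x) contains P + M^N. Passing from N to N + 1 thus costs at most
    the colength of P + Rx + M^(N+1), and summing raises the order by at most one. *)
Lemma slow_growth_adjoin n P x : is_ideal P -> M x ->
  slow_growth n (adjoin P x) -> slow_growth n.+1 P.
Proof.
move=> hP Mx [C hC]; exists C; elim=> [|N IHN].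
  have -> : ideal_add P (idpow M 0) = setT.
    by apply: ideal1; [exact: ideal_add_ideal hP (idpow_ideal M 0)|exact: ideal_addr].
  exact: len_le_setT.
have hN := idpow_ideal M.
apply: (@len_le_leq _ (C * N.+2 ^ n + C * N.+1 ^ n.+1)).
  rewrite -mulnDr leq_mul2l [X in (_ <= X)%N]expnS mulSn leq_add2l expnS leq_mul2l.
  by rewrite leq_expn ?orbT.
apply: (len_le_add (x := x)); first exact: ideal_add_ideal.
  by rewrite adjoin_add.
apply: len_le_mono IHN; apply: ideal_add_sub.
- by apply: colon_elt_ideal; exact: ideal_add_ideal.
- apply: subset_trans (@sub_colon_elt _ _ _ _); first exact: ideal_addl.
  exact: ideal_add_ideal.
- move=> b Mb; apply: ideal_addr => //; rewrite mulrC; exact: idpowS_mem.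
Qed.

Lemma slow_growth_maximal n : slow_growth n M.
Proof.
exists 1%N => N; rewrite mul1n; apply: (@len_le_leq _ 1%N); first by rewrite expn_gt0.
by apply: len_le_mono (maximal_len_le mM); apply: ideal_addl; exact: idpow_ideal.
Qed.

(** Some prime above I already grows too fast. It is not M, whose colengths are bounded, which
    provides x. *)
Lemma fast_growth_prime n I : is_ideal I -> ~ slow_growth n I -> exists P x,
  [/\ is_prime_ideal P, I `<=` P, M x, ~ P x & ~ slow_growth n P].
Proof.
move=> hI nslow; apply: contrapT => noP; apply: nslow.
apply: slow_growth_prime => // P pP IP; apply: contrapT => nP; apply: noP; exists P.
have [x [Mx nPx]] : exists x, M x /\ ~ P x; last by exists x.
apply: contrapT => nox; apply: nP; have -> : P = M; last exact: slow_growth_maximal.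
apply/seteqP; split=> [|x Mx]; first exact: prime_sub_maximal.
by apply: contrapT => nPx; apply: nox; exists x.
Qed.

Lemma fast_growth_tower n I : is_ideal I -> ~ slow_growth n I -> prime_tower n.+1 I.
Proof.
elim: n I => [|n IHn] I hI /(fast_growth_prime hI)[P [x [pP IP Mx nPx nP]]];
  exists P, x; split=> //.
  by exists M; [exact: maximal_prime|apply: adjoin_sub => //; exact: prime_sub_maximal].
have hP : is_ideal P by case: pP.
apply: IHn; first exact: adjoin_ideal.
by move=> slow; apply: nP; apply: slow_growth_adjoin slow.
Qed.

End Growth.

(** * Kunz's theorem *)

Section KunzLocal.
Variables (R : comPzRingType) (p : nat) (M : set R).
Hypotheses (nR : noetherian R) (pp : prime p) (p0 : p%:R = 0 :> R).
Hypothesis locM : is_local_with M.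
Implicit Types (I J K P Q : set R) (x z r u a b : R).

Let mM : is_maximal_ideal M. Proof. by case: locM. Qed.
Let hM : is_ideal M. Proof. by case: mM. Qed.
Let M1 : ~ M 1. Proof. by case: mM. Qed.
Let addp e : additive_power R (p ^ e). Proof. exact: additive_power_prime. Qed.
Let pe0 e : (0 < p ^ e)%N. Proof. by rewrite expn_gt0 prime_gt0. Qed.

(** Were the colon not proper, x_i would be redundant and n - 1 generators would suffice. *)
Lemma min_generators_colon n (x : 'I_n -> R) i : M = fspan x ->
  min_number_generators M n ->
  colon_elt (ideal_gen [set` [seq x j | j <- enum (predC1 i)]]) (x i) `<=` M.
Proof.
set G := ideal_gen _ => eM [_ minM]; have hG : is_ideal G by exact: ideal_gen_ideal.
apply: (proper_sub_maximal nR locM); first exact: colon_elt_ideal.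
rewrite /colon_elt /= mul1r => Gx.
have MG : M = G.
  rewrite eM; apply/seteqP; split.
    apply: span_sub => // j; have [->//|ji] := eqVneq j i.
    by apply: sub_ideal_gen; apply: map_f; rewrite mem_enum.
  by apply: ideal_gen_sub => [|_ /mapP[j _ ->]]; [exact: span_ideal|exact: mem_span].
have := minM _ MG; rewrite size_map -cardE cardC1 card_ord; have := ltn_ord i; lia.
Qed.

(** A relation puts c_i x_i^q in G^[q], where G is generated by the other x_j. By (C), c_i lies in
    (G : x_i)^[q], and (G : x_i) is inside M. *)
Lemma min_generators_independent n (x : 'I_n -> R) e : M = fspan x ->
  min_number_generators M n -> frobenius_colon R (p ^ e) ->
  independent (fun i => x i ^+ (p ^ e)).
Proof.
move=> eM minM cR c c0 i; rewrite -(frobenius_power_fspan (addp e) (pe0 e)) -eM.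
apply: (frobenius_power_mono (min_generators_colon (i := i) eM minM)).
apply: cR; first exact: ideal_gen_ideal.
set G := ideal_gen _; have hF := frobenius_power_ideal G (p ^ e).
have -> : c i * x i ^+ (p ^ e) = - \sum_(j < n | j != i) c j * x j ^+ (p ^ e).
  by apply/eqP; rewrite -addr_eq0 -[X in _ == X]c0 [X in _ == X](bigD1 i).
apply: (idealN hF); apply: (ideal_sum _ hF) => j ji; apply: (idealMl _ hF).
apply: mem_frobenius_power; apply: sub_ideal_gen; apply: map_f.
by rewrite mem_enum.
Qed.

Lemma fast_growth_of_colon d (x : 'I_d.+1 -> R) : M = fspan x ->
  min_number_generators M d.+1 -> (forall e, frobenius_colon R (p ^ e)) ->
  ~ slow_growth M d [set 0].
Proof.
move=> eM minM cR [C hC].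
(* M^[q] has colength at least q^(d+1) and contains the power of M with exponent (d+1) q + 1. Slow
   growth would bound this by C ((d+1) q + 2)^d <= C (d+3)^d q^d, and p^e > e makes that less than
   q^(d+1). *)
pose e := (C * d.+3 ^ d)%N; pose q := (p ^ e)%N.
have mx : is_maximal_ideal (fspan x) by rewrite -eM.
have := span_powers_len_ge mx (e := fun=> q) (fun=> pe0 e) (min_generators_independent eM minM (cR e)).
rewrite prod_nat_const card_ord => lge.
have hS := span_ideal (fun i => x i ^+ q).
have /hC : len_ge (q ^ d.+1) (ideal_add [set 0] (idpow M (d.+1 * q).+1)).
  apply: len_ge_mono lge; apply: ideal_add_sub => // [_ ->|]; first exact: ideal0.
  have := idpow_span_sub (t := x) (N := fun=> q) hS (fun i => mem_span _ i).
  by rewrite sum_nat_const card_ord -eM.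
have qe : (e < q)%N by apply: ltn_expl; exact: prime_gt1.
apply/negP; rewrite -ltnNge.
apply: (@leq_ltn_trans (C * (d.+3 * q) ^ d)).
  by rewrite leq_mul2l leq_expn ?orbT //; move: qe; nia.
by rewrite expnMn mulnA expnS ltn_pmul2r // expn_gt0 pe0.
Qed.

Lemma regular_local_of_colon :
  (forall e, frobenius_colon R (p ^ e)) -> regular_local R.
Proof.
move=> cR; split=> //; exists M; split=> //.
have [d minM] := exists_min_number_generators nR hM; exists d; split=> //.
have [[s [sd]]] := minM; rewrite gen_seq_span; move: (fun i : 'I_(size s) => s`_i).
rewrite sd => x eM _; split; last by move=> n; exact: (prime_chain_le nR locM eM).
(* Without generators the chain is M alone; otherwise the zero ideal grows faster than order d,
   which yields d + 1 strict steps. *)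
case: d x eM minM {sd} => [|d] x eM minM.
  by exists (fun=> M); split=> // i _; exact: maximal_prime.
have h0 : is_ideal [set 0 : R].
  by split=> // [a b -> ->|r a ->]; rewrite ?addr0 ?mulr0.
have := fast_growth_tower nR locM h0 (fast_growth_of_colon eM minM cR).
by move=> /prime_tower_chain[P [pP PS _]]; exists P.
Qed.

(** * Regular local rings: exact colengths of Frobenius powers *)

Section Regular.
Variables (d : nat) (x : 'I_d -> R).
Hypotheses (eM : M = fspan x) (chainM : prime_chain R d).

(** The M-primary ideals together with R itself: a class of ideals of finite colength stable under
    adjoining, colons and Frobenius powers. *)
Definition contains_pow I := is_ideal I /\ exists N, idpow M N `<=` I.

Lemma contains_pow_sub I J : is_ideal J -> I `<=` J -> contains_pow I -> contains_pow J.
Proof. by move=> hJ IJ [_ [N MN]]; split=> //; exists N; exact: subset_trans IJ. Qed.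

Lemma contains_pow_adjoin I z : contains_pow I -> contains_pow (adjoin I z).
Proof.
move=> cI; apply: contains_pow_sub (cI); last exact: sub_adjoin.
by apply: adjoin_ideal; case: cI.
Qed.

Lemma contains_pow_colon I z : contains_pow I -> contains_pow (colon_elt I z).
Proof.
move=> cI; apply: contains_pow_sub (cI); last by apply: sub_colon_elt; case: cI.
by apply: colon_elt_ideal; case: cI.
Qed.

Lemma contains_pow_frobenius I q : contains_pow I -> contains_pow (frobenius_power I q).
Proof.
move=> [hI [N MN]]; split; first exact: frobenius_power_ideal.
exists (\sum_(i < d) N * q).+1; rewrite eM; apply: idpow_span_sub.
  exact: frobenius_power_ideal.
move=> i; rewrite exprM; apply: mem_frobenius_power; apply: MN; apply: idpow_expr.
by rewrite eM; exact: mem_span.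
Qed.

Lemma contains_pow_maximal : contains_pow M.
Proof. by split=> //; exists 1%N; rewrite idpow1. Qed.

Lemma contains_pow_finite I : contains_pow I -> finite_len I.
Proof.
move=> [_ [N MN]]; apply: finite_len_mono MN _; exists (N ^ d)%N.
exact: (idpow_len_le locM eM).
Qed.

Let fin_frob I q : contains_pow I -> finite_len (frobenius_power I q).
Proof. by move=> cI; apply: contains_pow_finite; exact: contains_pow_frobenius. Qed.

(** Additivity is exact for I^[q] and z^q; the inequality comes from the inclusion of (I : z)^[q] in
    (I^[q] : z^q). *)
Lemma len_frobenius_split e I z : contains_pow I ->
  (len (frobenius_power I (p ^ e)) <=
   len (frobenius_power (adjoin I z) (p ^ e)) + len (frobenius_power (colon_elt I z) (p ^ e)))%N.
Proof.
move=> cI; have [hI _] := cI.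
rewrite (len_colon (z ^+ (p ^ e)) (frobenius_power_ideal I (p ^ e)) (fin_frob _ cI)).
rewrite (frobenius_power_adjoin (addp e)) // leq_add2l.
apply: len_mono (frobenius_colon_sub hI) _.
by apply: fin_frob; exact: contains_pow_colon.
Qed.

(** Induction on the colength. With z in M but not in I, both I + Rz and (I : z) are proper, so each
    has smaller colength than I. *)
Lemma len_frobenius_le e I : contains_pow I ->
  (len (frobenius_power I (p ^ e)) <= len (frobenius_power M (p ^ e)) * len I)%N.
Proof.
have [m] := ubnP (len I); elim: m I => // m IHm I Im cI.
have [hI _] := cI; have fI := contains_pow_finite cI.
have [I1|nI1] := pselect (I 1).
  rewrite (ideal1 (frobenius_power_ideal I _)) ?len_setT //.
  by rewrite -(expr1n _ (p ^ e)); exact: mem_frobenius_power.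
have IM := proper_sub_maximal nR locM hI nI1.
have [MI|/existsNP[z /not_implyP[Mz nIz]]] := pselect (M `<=` I).
  have -> : I = M by apply/seteqP.
  by rewrite leq_pmulr // len_gt0 //; apply: contains_pow_finite; exact: contains_pow_maximal.
have cA := contains_pow_adjoin z cI; have cC := contains_pow_colon z cI.
have eI := len_colon z hI fI.
have A0 : (0 < len (adjoin I z))%N.
  apply: len_gt0; first exact: contains_pow_finite.
  by move=> A1; apply: M1; exact: (adjoin_sub hM IM Mz A1).
have C0 : (0 < len (colon_elt I z))%N.
  apply: len_gt0; first exact: contains_pow_finite.
  by rewrite /colon_elt /= mul1r.
apply: leq_trans (len_frobenius_split e z cI) _; rewrite eI mulnDr.
by apply: leq_add; apply: IHm => //; lia.
Qed.

Lemma len_frobenius_iter e j :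
  (len (frobenius_power M ((p ^ e) ^ j)) <= len (frobenius_power M (p ^ e)) ^ j)%N.
Proof.
elim: j => [|j IHj].
  have -> : frobenius_power M ((p ^ e) ^ 0) = M.
    apply/seteqP; split; first by apply: frobenius_power_sub => // a; rewrite expr1.
    by move=> a Ma; rewrite -[a]expr1; exact: mem_frobenius_power.
  apply/len_leP; last exact: maximal_len_le.
  exact: contains_pow_finite contains_pow_maximal.
rewrite expnSr -(frobenius_power_comp (addp e) (pe0 e)).
apply: leq_trans (len_frobenius_le _ _) _.
  by apply: contains_pow_frobenius; exact: contains_pow_maximal.
by rewrite expnS leq_mul2l IHj orbT.
Qed.

(* A value t < q^d would make the length of R/M^k grow like a power of k with
   exponent less than d. *)
Lemma len_frobenius_maximal e : len (frobenius_power M (p ^ e)) = ((p ^ e) ^ d)%N.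
Proof.
set q := (p ^ e)%N; set t := len _.
have cF := contains_pow_frobenius q contains_pow_maximal.
have fF := contains_pow_finite cF.
have mx : is_maximal_ideal (fspan x) by rewrite -eM.
apply/eqP; rewrite eqn_leq; apply/andP; split.
  apply/len_leP => //; rewrite eM (frobenius_power_fspan (addp e) (pe0 e)).
  by have := span_powers_len_le mx (e := fun=> q); rewrite prod_nat_const card_ord.
rewrite leqNgt; apply/negP => tq.
have [q1|q1] := leqP q 1.
  have qE : q = 1%N by apply/eqP; rewrite eqn_leq q1 pe0.
  move: tq; rewrite qE exp1n ltnS leqn0 => /eqP t0.
  have : (0 < t)%N; last by rewrite t0.
  apply: len_gt0 => // F1; apply: M1; apply: (frobenius_power_sub hM _ F1) => a Ma.
  exact: idealX hM (pe0 e) Ma.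
have [P [pP PS]] := chainM.
have [c [C [c0 g]]] := chain_growth nR locM pP PS.
(* Since c <= q^c, M^[q^(c+j)] lies in the power of M with exponent c q^j. The chain then gives
   q^(jd) <= C t^(c+j), while t + 1 <= q^d makes the left side at least (t+1)^j. *)
have [j jt] := exp_overtakes t (C * t ^ c).
have [l ql gl] := g (q ^ j)%N (ltac:(by rewrite expn_gt0 pe0)).
have lt : (l <= t ^ (c + j))%N.
  apply: leq_trans (len_frobenius_iter e (c + j)); rewrite -/q.
  apply/len_geP; first by apply: fin_frob; exact: contains_pow_maximal.
  apply: len_ge_mono gl; apply: frobenius_power_sub => [|a Ma].
    by apply: ideal_add_ideal; [case: (pP 0%N isT)|exact: idpow_ideal].
  apply: ideal_addr; first by case: (pP 0%N isT).
  apply: (@idpow_le _ _ _ (q ^ (c + j))); last exact: idpow_expr.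
  by rewrite expnD leq_mul2r ltnW ?orbT // ltn_expl.
have : (t.+1 ^ j <= C * t ^ c * t ^ j)%N.
  apply: (@leq_trans ((q ^ j) ^ d)).
    by rewrite -expnM [(j * d)%N]mulnC expnM leq_expn.
  by apply: leq_trans ql _; rewrite -mulnA -expnD leq_mul2l lt orbT.
by rewrite leqNgt jt.
Qed.

(* Monotonicity of the defect [q^d len I - len I^[q]], written without subtraction. *)
Lemma len_frobenius_defect e I J : contains_pow I -> is_ideal J -> I `<=` J ->
  (len (frobenius_power I (p ^ e)) + (p ^ e) ^ d * len J <=
   len (frobenius_power J (p ^ e)) + (p ^ e) ^ d * len I)%N.
Proof.
have [m] := ubnP (len I); elim: m I => // m IHm I Im cI hJ IJ.
have [hI _] := cI; have fI := contains_pow_finite cI.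
have [JI|/existsNP[z /not_implyP[Jz nIz]]] := pselect (J `<=` I).
  by have -> : I = J by apply/seteqP.
have cA := contains_pow_adjoin z cI; have cC := contains_pow_colon z cI.
have eI := len_colon z hI fI.
have C0 : (0 < len (colon_elt I z))%N.
  apply: len_gt0; first exact: contains_pow_finite.
  by rewrite /colon_elt /= mul1r.
have IA : (len (adjoin I z) < m)%N by lia.
have := IHm _ IA cA hJ (adjoin_sub hJ IJ Jz).
have := len_frobenius_split e z cI; have := len_frobenius_le e cC.
rewrite len_frobenius_maximal eI mulnDr; lia.
Qed.

Lemma len_frobenius e I : contains_pow I ->
  len (frobenius_power I (p ^ e)) = ((p ^ e) ^ d * len I)%N.
Proof.
move=> cI; apply/eqP; rewrite eqn_leq -{1}len_frobenius_maximal len_frobenius_le //=.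
have [hI [N MN]] := cI.
have FI : frobenius_power M (p ^ N) `<=` I.
  apply: frobenius_power_sub => // a Ma; apply: MN.
  apply: (@idpow_le _ _ _ (p ^ N)); last exact: idpow_expr.
  by rewrite ltnW // ltn_expl // prime_gt1.
(* For M^[Q] with Q = p^N the defect vanishes, since M^[Q] and M^[Qq] have colengths Q^d and (Qq)^d;
   by monotonicity it vanishes for I too. *)
have := len_frobenius_defect e (contains_pow_frobenius _ contains_pow_maximal) hI FI.
rewrite frobenius_power_comp // -expnD !len_frobenius_maximal expnD expnMn.
by rewrite [X in (_ <= _ + X)%N]mulnC [X in (X <= _)%N]addnC leq_add2r.
Qed.

(** The colengths of a^[q] and (a + Rz)^[q] are q^d times those of a and a + Rz. Subtracting, (a^[q]
    : z^q) and its subideal (a : z)^[q] have equal colength, so they coincide. *)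
Lemma frobenius_colon_of_regular e : frobenius_colon R (p ^ e).
Proof.
apply: frobenius_colon_of_pow => // M' mM' a N ha Ma z r.
have {mM'} eM' : M' = M by case: locM => _; apply.
have ca : contains_pow a by split=> //; exists N; rewrite -eM'.
have cC := contains_pow_colon z ca; have hC := colon_elt_ideal z ha.
have eF := len_colon (z ^+ (p ^ e)) (frobenius_power_ideal a (p ^ e)) (fin_frob _ ca).
have ea := len_colon z ha (contains_pow_finite ca).
have := len_eq (J := colon_elt (frobenius_power a (p ^ e)) (z ^+ (p ^ e))) _
  (frobenius_colon_sub ha) (fin_frob _ cC) _.
move=> -> //; first by apply: colon_elt_ideal; exact: frobenius_power_ideal.
move: eF; rewrite -(frobenius_power_adjoin (addp e)) // !len_frobenius //; last exact: contains_pow_adjoin.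
by rewrite ea mulnDr => /addnI ->.
Qed.

End Regular.
End KunzLocal.

Lemma regular_local_colon (R : comPzRingType) p e : prime p -> p%:R = 0 :> R ->
  regular_local R -> frobenius_colon R (p ^ e).
Proof.
move=> pp p0 [nR [M [locM [d [[chainM _] [[s [sd]]]]]]]].
rewrite gen_seq_span; move: (fun i : 'I_(size s) => s`_i); rewrite sd => x eM _.
exact: (frobenius_colon_of_regular nR pp p0 locM eM chainM).
Qed.

(** A failure of (C) at r has its colon ideal inside some maximal M, and (C) in the localization at
    M yields an element of that colon outside M. Conversely (C) passes to every localization. *)
Lemma regular_ring_iff_colon (R : comPzRingType) p :
  noetherian R -> prime p -> p%:R = 0 :> R ->
  regular_ring R <-> forall e, frobenius_colon R (p ^ e).
Proof.
move=> nR pp p0.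
have pS (P : prime_ideal R) : p%:R = 0 :> localization P.
  by rewrite -(rmorph_nat (@loc_map R P)) p0 rmorph0.
split=> [[_ regR] e I hI x r Ir|cR].
  apply: contrapT => nKr; set K := frobenius_power _ _ in nKr.
  have hK : is_ideal K := frobenius_power_ideal _ _.
  have [|M mM KM] := exists_maximal nR (colon_elt_ideal r hK).
    by rewrite /colon_elt /= mul1r.
  pose P := PrimeIdeal (maximal_prime mM).
  have [u Mu Ku] := frobenius_colon_contract (maximal_prime mM) (loc_map_localization P)
    (regular_local_colon (e := e) pp (pS P) (regR P)) hI Ir.
  by apply: Mu; exact: KM.
split=> // P; have pP := prime_idealP P; have locP := loc_map_localization P.
apply: (regular_local_of_colon (localization_noetherian pP locP nR) pp (pS P)
  (localization_local pP locP)) => e.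
exact: (frobenius_colon_localization pP locP (cR e)).
Qed.

Theorem theorem2p4 (R : comPzRingType) (p : nat)
    (hR : noetherian R) (hp : prime p) (hpR : p%:R = 0 :> R) :
  let cond1 := regular_ring R in
  let cond2 := forall I J : set R, is_ideal I -> is_ideal J -> forall e : nat,
    colon (frobenius_power I (p ^ e)) (frobenius_power J (p ^ e)) =
    frobenius_power (colon I J) (p ^ e) in
  let cond3 := forall a : set R,
    (exists M : set R, is_maximal_ideal M /\ is_primary_to a M) ->
    forall (x : R) (e : nat),
      colon_elt (frobenius_power a (p ^ e)) (x ^+ (p ^ e)) =
      frobenius_power (colon_elt a x) (p ^ e) in
  (cond1 <-> cond2) /\ (cond1 <-> cond3).
Proof.
move=> cond1 cond2 cond3.
have addp e : additive_power R (p ^ e) := additive_power_prime e hp hpR.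
have p0 e : (0 < p ^ e)%N by rewrite expn_gt0 prime_gt0.
have reg_colon : cond1 <-> forall e, frobenius_colon R (p ^ e).
  exact: regular_ring_iff_colon.
split; split=> [/reg_colon cR|cond].
- by move=> I J hI hJ e; exact: frobenius_colon_ideal.
- apply/reg_colon => e I hI x r Ir.
  have hF := frobenius_power_ideal I (p ^ e).
  (* Condition (2) is applied to the principal ideal J = (x), whose Frobenius power is generated by
     x^q. *)
  have : colon (frobenius_power I (p ^ e)) (frobenius_power (ideal_gen [set x]) (p ^ e)) r.
    move=> y; rewrite frobenius_power_gen // mulrC.
    apply: (ideal_gen_sub (colon_elt_ideal r hF)) => _ [_ -> <-].
    by rewrite /colon_elt /= mulrC.
  rewrite cond //; last exact: ideal_gen_ideal.
  by apply: frobenius_power_mono => a; apply; exact: sub_ideal_gen.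
- by move=> a [M [_ [[ha _ _] _]]] x e; exact: frobenius_colon_elt.
- apply/reg_colon => e; apply: frobenius_colon_of_pow => // M mM a N ha Ma x r ar.
  (* The unit ideal contains powers of M without being primary, so (3) does not cover it; there (a :
     x) is R as well. *)
  have [a1|na1] := pselect (a 1).
    rewrite (ideal1 (frobenius_power_ideal _ _)) // -(expr1n _ (p ^ e)).
    by apply: mem_frobenius_power; rewrite /colon_elt /= mul1r (ideal1 ha).
  by rewrite -cond //; exists M; split=> //; exact: pow_sub_primary Ma.
Qed.
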